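(* There is an algorithm which, given a $321$-avoiding permutation $\tau$ of size $n$ and a $321$-avoiding permutation $\pi$ of size $k$, determines whether $\tau$ contains $\pi$, and whose running time is $O(kn)$.
   Context: A permutation of size $n$ is a bijection $\sigma:[n]\to[n]$, $[n]=\{1,\dots,n\}$, identified with its set of points $\{(i,\sigma(i))\}$. A point $(i,\sigma(i))$ lies to the left of $(j,\sigma(j))$ if $i<j$ and below it if $\sigma(i)<\sigma(j)$. An embedding of $\pi$ into $\tau$ is an injective map $f$ from the points of $\pi$ to the points of $\tau$ such that for all points $x,y$ of $\pi$, $f(x),f(y)$ are in the same relative horizontal and vertical order as $x,y$. $\tau$ contains $\pi$ if such an embedding exists. A permutation is $321$-avoiding if it contains no three points $a,b,c$ with $a$ left of $b$ left of $c$ and $a$ above $b$ above $c$. Running time is measured in the standard RAM model with $\pi,\tau$ given in one-line notation. *)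

(* Defs.v *)
From mathcomp Require Import all_boot all_fingroup.
Set Implicit Arguments. Unset Strict Implicit. Unset Printing Implicit Defensive.

(* A permutation of size n is sigma : 'S_n, a bijection of 'I_n = {0..n-1}
   (the paper's [n] = {1..n}, shifted by one).  Its points are (i, sigma i). *)

Definition avoids321 n (s : 'S_n) : Prop :=
  ~ exists a b c : 'I_n, [/\ a < b, b < c, s b < s a & s c < s b].

(* An embedding of pi into tau: an injective map f on points (point i of pi is
   (i, pi i), sent to the point (f i, tau (f i)) of tau) preserving the relative
   horizontal and vertical order of every pair of points. *)
Definition embedding k n (pi : 'S_k) (tau : 'S_n) (f : 'I_k -> 'I_n) : Prop :=
  injective f /\
  forall x y : 'I_k,
    ((x < y) = (f x < f y)) /\ ((pi x < pi y) = (tau (f x) < tau (f y))).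

Definition contains k n (tau : 'S_n) (pi : 'S_k) : Prop :=
  exists f : 'I_k -> 'I_n, embedding pi tau f.

(* Memory: an infinite array of natural-number cells indexed by nat.
   Every instruction costs one time unit.  Arithmetic is addition and
   truncated subtraction plus comparison; indirect addressing is available. *)
Inductive instr : Type :=
  | IConst of nat & nat        (* IConst r c  : M[r] := c                    *)
  | IAdd   of nat & nat & nat  (* IAdd r a b  : M[r] := M[a] + M[b]          *)
  | ISub   of nat & nat & nat  (* ISub r a b  : M[r] := M[a] - M[b] (trunc.) *)
  | ILt    of nat & nat & nat  (* ILt r a b   : M[r] := (M[a] < M[b])        *)
  | ILoad  of nat & nat        (* ILoad r a   : M[r] := M[M[a]]              *)
  | IStore of nat & nat        (* IStore a b  : M[M[a]] := M[b]              *)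
  | IJz    of nat & nat        (* IJz a l     : if M[a] = 0 then goto l      *)
  | IJmp   of nat              (* IJmp l      : goto l                       *)
  | IHalt.

Definition program := seq instr.
Definition memory := nat -> nat.

Definition upd (m : memory) (r v : nat) : memory :=
  fun x => if x == r then v else m x.

(* exec t P pc m = Some m' iff the machine started at program counter pc with
   memory m halts (executes IHalt, or runs off the program) within t steps,
   with final memory m'.  Each executed instruction (including the halt)
   costs one step. *)
Fixpoint exec (t : nat) (P : program) (pc : nat) (m : memory) : option memory :=
  match t with
  | 0 => None
  | t'.+1 =>
    match nth IHalt P pc with
    | IConst r c => exec t' P pc.+1 (upd m r c)
    | IAdd r a b => exec t' P pc.+1 (upd m r (m a + m b))
    | ISub r a b => exec t' P pc.+1 (upd m r (m a - m b))
    | ILt r a b => exec t' P pc.+1 (upd m r (nat_of_bool (m a < m b)))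
    | ILoad r a => exec t' P pc.+1 (upd m r (m (m a)))
    | IStore a b => exec t' P pc.+1 (upd m (m a) (m b))
    | IJz a l => exec t' P (if m a == 0 then l else pc.+1) m
    | IJmp l => exec t' P l m
    | IHalt => Some m
    end
  end.

(* Input encoding (one-line notation, values 1..size):
   M[0] = n, M[1] = k, M[2 .. n+1] = tau(1) .. tau(n),
   M[n+2 .. n+k+1] = pi(1) .. pi(k), all other cells 0. *)
Definition one_line n (s : 'S_n) : seq nat := [seq (s i).+1 | i <- enum 'I_n].

Definition init_mem k n (tau : 'S_n) (pi : 'S_k) : memory :=
  fun x => nth 0 ([:: n; k] ++ one_line tau ++ one_line pi) x.

(* Main.v *)
Require Import Defs.
From mathcomp Require Import all_boot all_fingroup.
From mathcomp Require Import zify.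

Set Implicit Arguments. Unset Strict Implicit. Unset Printing Implicit Defensive.

(** A 321-avoiding permutation is the union of two increasing sequences: the points with
    [s i >= i] (upper) and those with [s i < i] (lower); tops of inversions are upper and
    bottoms of inversions are lower.  Hence an embedding sends every point of the pattern
    that is not a fixed point to a point of the same kind, whereas a fixed point takes part
    in no inversion and may go to either kind.  Once the kinds are chosen, each point ranges
    over an increasing sequence and the constraints "right of the previous point" and "above
    the next lower point" are closed under pointwise minimum, so starting from the leftmost
    candidates and advancing any point that violates one of its two constraints converges
    to the leftmost embedding, in at most [k n] advances.  A fixed point separates what is
    before it from what is after it, so it suffices to keep, for each point, one candidate
    for each kind of the image of the last fixed point at or before it.  The machine model has
    no free low memory, so the input is first moved to a heap on which the program,
    written in a small while language with a verified compiler, then runs. *)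

(** * Inversions in 321-avoiding permutations *)

Lemma card_ord_lt n (m : 'I_n) : #|[set z : 'I_n | z < m]| = m.
Proof.
have le_mn : m <= n by apply: ltnW.
rewrite -sum1_card (eq_bigl (fun z : 'I_n => z < m)); last by move=> z; rewrite inE.
by rewrite -(big_ord_widen _ (fun=> 1) le_mn) sum_nat_const card_ord muln1.
Qed.

Lemma card_perm_lt n (s : 'S_n) (m : 'I_n) : #|[set z | s z < m]| = m.
Proof.
rewrite -[RHS]card_ord_lt -(card_preimset [set z : 'I_n | z < m] (@perm_inj _ s)).
by apply: eq_card => z; rewrite !inE.
Qed.

(** Every point with value below [s y] lies left of [y], or it would complete a 321 with [x] and
    [y]. The point [x] is also left of [y] but not among them, so counting gives a strict
    inequality. *)
Lemma avoids321_inversion_bottom n (s : 'S_n) (x y : 'I_n) :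
  avoids321 s -> x < y -> s y < s x -> s y < y.
Proof.
move=> av ltxy ltsyx; rewrite -(card_perm_lt s (s y)) -[X in _ < X]card_ord_lt.
apply: proper_card; apply/properP; split.
  apply/subsetP=> z; rewrite !inE => lez; case: (ltngtP z y) => // [ltyz|/val_inj eqzy].
    by case: av; exists x, y, z.
  by rewrite eqzy ltnn in lez.
by exists x; rewrite inE // -leqNgt ltnW.
Qed.

(** The dual count: points left of [x] have values below [s x], and [y] is one more such value. *)
Lemma avoids321_inversion_top n (s : 'S_n) (x y : 'I_n) :
  avoids321 s -> x < y -> s y < s x -> x < s x.
Proof.
move=> av ltxy ltsyx; rewrite -(card_perm_lt s (s x)) -[X in X < _]card_ord_lt.
apply: proper_card; apply/properP; split.
  apply/subsetP=> z; rewrite !inE => lez.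
  case: (ltngtP (s z) (s x)) => // [ltsxz|/val_inj/perm_inj eqzx].
    by case: av; exists z, x, y.
  by rewrite eqzx ltnn in lez.
by exists y; rewrite inE // -leqNgt ltnW.
Qed.

(** Pigeonhole, valid for any permutation: if every value below [s x] occurred left of [x], counting
    would give [s x <= x]. *)
Lemma perm_exceed n (s : 'S_n) (x : 'I_n) :
  x < s x -> exists2 y : 'I_n, x < y & s y < s x.
Proof.
move=> ltx; suff /existsP[y /andP[? ?]] : [exists y : 'I_n, (x < y) && (s y < s x)] by exists y.
apply: contraLR ltx; rewrite negb_exists -leqNgt => /forallP no.
rewrite -(card_perm_lt s (s x)) -[X in _ <= X]card_ord_lt.
apply: subset_leq_card; apply/subsetP=> z; rewrite !inE => lez.
have := no z; rewrite lez andbT -leqNgt leq_eqVlt => /orP[/eqP/val_inj eqz|//].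
by rewrite eqz ltnn in lez.
Qed.

Lemma perm_deficient n (s : 'S_n) (x : 'I_n) :
  s x < x -> exists2 y : 'I_n, y < x & s x < s y.
Proof.
move=> ltx; suff /existsP[y /andP[? ?]] : [exists y : 'I_n, (y < x) && (s x < s y)] by exists y.
apply: contraLR ltx; rewrite negb_exists -leqNgt => /forallP no.
rewrite -(card_perm_lt s (s x)) -[X in X <= _]card_ord_lt.
apply: subset_leq_card; apply/subsetP=> z; rewrite !inE => lez.
have := no z; rewrite lez /= -leqNgt leq_eqVlt => /orP[/eqP/val_inj/perm_inj eqz|//].
by rewrite eqz ltnn in lez.
Qed.

(** * One-line notation with positions and values counted from 1 *)

Definition oneval n (s : 'S_n) (x : nat) : nat :=
  if x is x'.+1 then nth 0 (one_line s) x' else 0.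

Lemma size_one_line n (s : 'S_n) : size (one_line s) = n.
Proof. by rewrite size_map size_enum_ord. Qed.

Lemma oneval_ord n (s : 'S_n) (i : 'I_n) : oneval s i.+1 = (s i).+1.
Proof.
by rewrite /= (nth_map i) ?size_enum_ord // nth_ord_enum.
Qed.

(** Stated for a bare function constrained only on [[1, N]], so that raw memory reads can play the
    permutation and 0 stays free as a sentinel. *)
Record perm321 (N : nat) (s : nat -> nat) : Prop := Perm321 {
  perm321_range : forall x, 0 < x <= N -> 0 < s x <= N;
  perm321_surj : forall v, 0 < v <= N -> exists2 x, 0 < x <= N & s x = v;
  perm321_inj : forall x y, 0 < x <= N -> 0 < y <= N -> s x = s y -> x = y;
  perm321_inv : forall x y, 0 < x -> x < y -> y <= N -> s y < s x ->
    x < s x /\ s y < y;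
  perm321_exceed : forall x, 0 < x <= N -> x < s x ->
    exists2 y, x < y <= N & s y < s x;
  perm321_deficient : forall x, 0 < x <= N -> s x < x ->
    exists2 y, 0 < y < x & s x < s y }.

Lemma ord_of_pos N x : 0 < x <= N -> exists i : 'I_N, x = i.+1.
Proof. by case: x => // x /= ltx; exists (Ordinal ltx). Qed.

Lemma oneval_perm321 N (s : 'S_N) : avoids321 s -> perm321 N (oneval s).
Proof.
move=> av; split.
- by move=> _ /ord_of_pos[i ->]; rewrite oneval_ord ltn_ord.
- move=> _ /ord_of_pos[i ->]; exists ((s^-1)%g i).+1; first exact: ltn_ord.
  by rewrite oneval_ord permKV.
- move=> _ _ /ord_of_pos[i ->] /ord_of_pos[j ->]; rewrite !oneval_ord.
  by move=> [/val_inj/perm_inj ->].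
- move=> x y x0 ltxy leyN.
  have [|i ei] := @ord_of_pos N x; first by lia.
  have [|j ej] := @ord_of_pos N y; first by lia.
  move: ltxy; rewrite ei ej !oneval_ord !ltnS => ltij lts; split.
    exact: avoids321_inversion_top lts.
  exact: avoids321_inversion_bottom lts.
- move=> _ /ord_of_pos[i ->]; rewrite oneval_ord ltnS => /perm_exceed[j ltij ltsji].
  by exists j.+1; rewrite ?oneval_ord //= ltnS ltij ltn_ord.
- move=> _ /ord_of_pos[i ->]; rewrite oneval_ord ltnS => /perm_deficient[j ltij ltsji].
  by exists j.+1; rewrite ?oneval_ord //= ltnS ltij.
Qed.

Definition pos_embedding k n (P T f : nat -> nat) : Prop :=
  [/\ forall x, 0 < x <= k -> 0 < f x <= n,
      forall x y, 0 < x -> x < y -> y <= k -> f x < f y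
    & forall x y, 0 < x <= k -> 0 < y <= k -> P x < P y -> T (f x) < T (f y)].

(** The one-way implications of [pos_embedding] yield the equivalences of [embedding] by trichotomy;
    injectivity of [pi] excludes ties in value. *)
Lemma contains_pos_embedding n k (tau : 'S_n) (pi : 'S_k) :
  contains tau pi <-> exists f, pos_embedding k n (oneval pi) (oneval tau) f.
Proof.
split=> [[f [injf ordf]]|[f [f_rng f_pos f_val]]].
  pose g x := if insub x.-1 is Some i then (f i).+1 else 0.
  have gE (i : 'I_k) : g i.+1 = (f i).+1 by rewrite /g /= valK.
  exists g; split.
  - by move=> _ /ord_of_pos[i ->]; rewrite gE ltn_ord.
  - move=> x y x0 ltxy leyk.
    have [|i ei] := @ord_of_pos k x; first by lia.
    have [|j ej] := @ord_of_pos k y; first by lia.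
    by move: ltxy; rewrite ei ej !gE !ltnS (ordf i j).1.
  - move=> _ _ /ord_of_pos[i ->] /ord_of_pos[j ->].
    by rewrite !gE !oneval_ord !ltnS (ordf i j).2.
have f_ord (i : 'I_k) : (f i.+1).-1 < n.
  by have := f_rng i.+1; have := ltn_ord i; lia.
pose g (i : 'I_k) : 'I_n := Ordinal (f_ord i).
have gE i : (g i).+1 = f i.+1 by rewrite /=; have := f_rng i.+1; have := ltn_ord i; lia.
have g_pos (i j : 'I_k) : i < j -> g i < g j.
  by move=> ltij; rewrite -ltnS !gE; apply: f_pos.
have g_val (i j : 'I_k) : pi i < pi j -> tau (g i) < tau (g j).
  move=> ltij; rewrite -ltnS -!oneval_ord !gE; apply: f_val; rewrite ?ltn_ord //.
  by rewrite !oneval_ord.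
exists g; split.
  move=> i j eqg; case: (ltngtP i j) => [/g_pos|/g_pos|/val_inj //];
  by rewrite eqg ltnn.
move=> i j; split.
  apply/idP/idP; first exact: g_pos.
  case: (ltngtP i j) => // [/g_pos|/val_inj ->]; first by move=> ?; lia.
  by rewrite ltnn.
apply/idP/idP; first exact: g_val.
case: (ltngtP (pi i) (pi j)) => // [/g_val|/val_inj/perm_inj ->]; first by move=> ?; lia.
by rewrite ltnn.
Qed.

(** * Leftmost candidates *)

Section Worklist.

Variables (n k : nat) (T P inv : nat -> nat).

(* Positions are counted from 1; candidate 0 belongs to the virtual points outside [1, k]
   and n + 1 means that no candidate is left.  The colour [c] is the kind (true for lower)
   of the image of the last fixed point at or before [x], so [P x < x + c] is the kind
   required of the image of [x]. *)
Definition suited (c : bool) x t := (T t < t) == (P x < x + c).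

(** The point just below [x] in value; for [P x = 1] it is the virtual point 0, because [inv 0] is
    0. *)
Definition below x := inv (P x).-1.

(* An unsuited candidate of [below x] is no lower bound for a value yet, so it must not
   make [x] advance. *)
Definition supported (r : bool -> nat -> nat) (c : bool) x t :=
  (r c x.-1 < t) && ((r c (below x) < n.+1) &&
  ((T (r c (below x)) < T t) || ~~ suited c (below x) (r c (below x)))).

(** Virtual points and exhausted candidates never move. At a fixed point the colour may switch, so
    the support may come from either colour, the same one for the left neighbour and for the point
    below. *)
Definition settled (r : bool -> nat -> nat) (c : bool) x :=
  [|| r c x == 0, n < r c x
    | suited c x (r c x) &&
      (supported r c x (r c x) || (P x == x) && supported r (~~ c) x (r c x))].

Definition advance r x (c : bool) y := r c y + ((y == x) && ~~ settled r c x).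

Hypotheses (HT : perm321 n T) (HP : perm321 k P).
Hypothesis (invP : forall v, inv v != 0 -> 0 < inv v <= k /\ P (inv v) = v).
Hypothesis (invK : forall x, 0 < x <= k -> inv (P x) = x).

Lemma inv0 : inv 0 = 0.
Proof.
apply/eqP; apply: contraT => nz; have [rx Px] := invP nz.
by have := perm321_range HP rx; rewrite Px.
Qed.

Lemma belowP x : 0 < x <= k -> 1 < P x -> 0 < below x <= k /\ P (below x) = (P x).-1.
Proof.
move=> rx Px; have := perm321_range HP rx => rP.
have [|y ry ey] := @perm321_surj _ _ HP (P x).-1; first lia.
by rewrite /below -ey invK // ry.
Qed.

Lemma fixed_below q x : q <= k -> P q = q -> 0 < x < q -> P x < q.
Proof.
move=> leq fq rx; rewrite ltnNge; apply/negP => leqx.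
have neq : P x != P q.
  by apply/eqP => /(perm321_inj HP); lia.
have [] := @perm321_inv _ _ HP x q; lia.
Qed.

Lemma fixed_above q x : 0 < q -> P q = q -> q < x <= k -> q < P x.
Proof.
move=> leq fq rx; rewrite ltnNge; apply/negP => leqx.
have neq : P x != P q.
  by apply/eqP => /(perm321_inj HP); lia.
have [] := @perm321_inv _ _ HP q x; lia.
Qed.

Lemma color_const (g : nat -> bool) u v : u <= v -> v <= k ->
  (forall x, 0 < x <= k -> P x != x -> g x = g x.-1) ->
  (forall q, u < q <= v -> P q != q) -> g v = g u.
Proof.
move=> leuv levk gP; elim: v leuv levk => [|v IH] leuv levk nofix.
  by have -> : u = 0 by lia.
case: (ltngtP u v.+1) leuv => // [ltuv _|-> //].
rewrite gP; [|lia|by apply: nofix; lia].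
by apply: IH => [||q rq]; [lia..|apply: nofix; lia].
Qed.

(* A fixed point separates everything before it from everything after it, so none lies
   strictly between a point and the point just below it in value. *)
Lemma color_below (g : nat -> bool) x :
  (forall y, 0 < y <= k -> P y != y -> g y = g y.-1) ->
  0 < x <= k -> 1 < P x -> g (below x) = g x.-1.
Proof.
move=> gP rx Px; have [rb Pb] := belowP rx Px.
case: (ltngtP (below x) x) => [ltbx|ltxb|eqbx]; last by move: Pb; rewrite eqbx; lia.
  symmetry; apply: color_const => //; [lia|lia|] => q rq; apply/eqP => fq.
  have := @fixed_below q (below x); have := @fixed_above q x; lia.
(* Here [x] and [below x] form an inversion, so neither is fixed; the range of [q] now includes
   both. *)
have [||||ex eb] := @perm321_inv _ _ HP x (below x); try lia.
apply: color_const => //; [lia|lia|] => q rq; apply/eqP => fq.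
have := @fixed_below q x; have := @fixed_above q (below x).
case: (ltngtP q x) => [| |eq]; [lia| |subst q; lia].
case: (ltngtP q (below x)) => [| |eq]; [lia|lia|subst q; lia].
Qed.

(** An inversion has an upper top and a lower bottom, so two points of the same kind never form
    one. *)
Lemma suited_mono t t' : 0 < t -> t' <= n -> (T t < t) = (T t' < t') ->
  t <= t' -> T t <= T t'.
Proof.
move=> t0 let' same; rewrite leq_eqVlt => /orP[/eqP -> //|ltt].
rewrite leqNgt; apply/negP => lt'; have [] := @perm321_inv _ _ HT t t'; lia.
Qed.

(** * Candidates never pass the image under an embedding *)

Section LowerBound.

Variable (f : nat -> nat).
Hypothesis (Hf : pos_embedding k n P T f).

(** The start value [false] is arbitrary: before the first fixed point, [suited] does not depend on
    the colour. *)
Fixpoint image_color x : bool :=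
  if x is x'.+1 then (if P x == x then T (f x) < f x else image_color x') else false.

Lemma image_color_nofix x : 0 < x <= k -> P x != x -> image_color x = image_color x.-1.
Proof. by case: x => //= x _ /negPf ->. Qed.

(** A point that is not fixed takes part in an inversion, whose image is an inversion and forces the
    kind. At a fixed point the colour is the kind of the image by definition. *)
Lemma image_suited x : 0 < x <= k -> suited (image_color x) x (f x).
Proof.
move=> rx; rewrite /suited; case: Hf => f_rng f_pos f_val; apply/eqP.
have rfx := f_rng x rx.
case: (ltngtP (P x) x) => [def|exc|fx].
- rewrite [P x < _](_ : _ = true); last lia.
  have [y ry Py] := perm321_deficient HP rx def.
  have ltf := f_val x y rx ltac:(lia) Py; have ltp := f_pos y x ltac:(lia) ltac:(lia) ltac:(lia).
  have [||_ ->] := @perm321_inv _ _ HT (f y) (f x) _ ltp _ ltf => //; last lia.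
  by have := f_rng y; lia.
- rewrite [P x < _](_ : _ = false); last by case: image_color; lia.
  have [y ry Py] := perm321_exceed HP rx exc.
  have ltf := f_val y x ltac:(lia) rx Py; have ltp := f_pos x y ltac:(lia) ltac:(lia) ltac:(lia).
  have [||? _] := @perm321_inv _ _ HT (f x) (f y) _ ltp _ ltf => //; last lia.
    lia.
  by have := f_rng y; lia.
- case: x rx fx rfx => //= x _ fx rfx; rewrite fx eqxx; case: (_ < _); lia.
Qed.

Definition lower_bound (r : bool -> nat -> nat) :=
  forall x, 0 < x <= k -> r (image_color x) x <= f x.

(** A candidate could overtake [f x] only by advancing from [f x] itself, but there it is settled,
    since the candidates that it is compared with are bounded by images under [f]. *)
Lemma advance_lower_bound r x : T 0 = 0 -> (forall c, r c 0 = 0) ->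
  (forall c y, 0 < y <= k -> 0 < r c y) ->
  0 < x <= k -> lower_bound r -> lower_bound (advance r x).
Proof.
move=> T0 r0 rpos rx lb y ry; rewrite /advance; have lby := lb y ry.
case: (eqVneq y x) => [eyx|_]; last by rewrite addn0.
subst y; case: (boolP (settled r _ x)) => [_|nset]; first by rewrite addn0.
rewrite addn1 ltn_neqAle lby andbT; apply: contra nset => /eqP erf.
case: (Hf) => f_rng f_pos f_val; have rfx := f_rng x rx.
rewrite /settled erf image_suited //=.
(* One colour serves both comparisons, because [below x] has the colour of [x.-1] by
   [color_below]. *)
have sup : supported r (image_color x.-1) x (f x).
  apply/andP; split.
    case: (ltngtP x 1) => [|gt1|ex1]; [lia| |by rewrite {2}ex1 r0; lia].
    by apply: (leq_ltn_trans (lb x.-1 ltac:(lia))); apply: f_pos; lia.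
  have rP := perm321_range HP rx.
  case: (ltngtP (P x) 1) => [|gt1|eq1]; first lia.
    have [rb Pb] := belowP rx gt1.
    rewrite -(color_below image_color_nofix rx gt1).
    have lbb := lb _ rb; have rfb := f_rng _ rb.
    apply/andP; split; first lia.
    (* Only a suited candidate must be compared; it has the kind of [f (below x)], so [suited_mono]
       turns the bound on positions into one on values. *)
    case: (boolP (suited _ _ _)); last by rewrite orbT.
    move=> /eqP sb; rewrite orbF.
    apply: (@leq_ltn_trans (T (f (below x)))); last by apply: f_val => //; lia.
    apply: suited_mono => //; [exact: rpos|lia|].
    by rewrite sb -(eqP (image_suited rb)).
  have -> : below x = 0 by rewrite /below eq1 inv0.
  by rewrite r0 T0; have := perm321_range HT rfx; lia.
case: (boolP (P x == x)) => [fx|nfx].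
  case: (eqVneq (image_color x.-1) (image_color x)) => [<-|]; first by rewrite sup !orbT.
  by move=> ne; rewrite [~~ _](_ : _ = image_color x.-1) ?sup ?orbT //;
     case: (image_color x) (image_color x.-1) ne => [] [].
by rewrite (image_color_nofix rx nfx) sup /= !orbT.
Qed.

End LowerBound.

(** * Reading an embedding off settled candidates *)

Section Readout.

Variables (r : bool -> nat -> nat) (c0 : bool).
Hypothesis (rpos : forall c x, 0 < x <= k -> 0 < r c x).
Hypothesis (all_settled : forall c x, settled r c x).
Hypothesis (r_fin : r c0 k <= n).

Definition previous_color x (c : bool) :=
  if (P x != x) || supported r c x (r c x) then c else ~~ c.

(** Colours are chosen from right to left, since the support found at a fixed point decides the
    colour before it; the recursion is on the distance to [k]. *)
Fixpoint color_from_top i : bool :=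
  if i is i'.+1 then previous_color (k - i') (color_from_top i') else c0.

Let color x := color_from_top (k - x).

Lemma color_prev x : 0 < x <= k -> color x.-1 = previous_color x (color x).
Proof.
move=> rx; rewrite /color (_ : k - x.-1 = (k - x).+1) /=; last lia.
by rewrite (_ : k - (k - x) = x) //; lia.
Qed.

(** Finiteness passes down from [k]: a settled finite candidate is supported, so its left neighbour
    has a smaller candidate in the chosen colour. *)
Lemma color_finite x : 0 < x <= k -> r (color x) x <= n /\
  suited (color x) x (r (color x) x) /\ supported r (color x.-1) x (r (color x) x).
Proof.
have fin y : 0 < y <= k -> r (color y) y <= n ->
  suited (color y) y (r (color y) y) /\ supported r (color y.-1) y (r (color y) y).
  move=> ry fy; have := all_settled (color y) y; have := rpos (color y) ry.
  rewrite /settled => p0; rewrite color_prev // /previous_color.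
  case/or3P; [lia|lia|] => /andP[-> /orP[sup|/andP[-> sup]]]; first by rewrite sup orbT.
  by split=> //; case: ifP.
move=> rx; suff fx : r (color x) x <= n by split=> //; apply: fin.
have [i ei] : exists i, i = k - x by exists (k - x).
elim: i x rx ei => [|i IH] x rx ei.
  by rewrite /color -ei (_ : x = k) //; lia.
have rx1 : 0 < x.+1 <= k by lia.
have fx1 := IH x.+1 rx1 ltac:(lia).
have [_ /andP[/= ltx _]] := fin _ rx1 fx1; lia.
Qed.

(** [supported] compares only neighbours in position and neighbours in value; one induction along
    each order chains these comparisons. *)
Lemma color_embedding : pos_embedding k n P T (fun x => r (color x) x).
Proof.
have color_nofix x : 0 < x <= k -> P x != x -> color x = color x.-1.
  by move=> rx nfx; rewrite color_prev // /previous_color nfx.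
split=> [x rx|x y x0 ltxy leyk|x y rx ry ltP].
- by rewrite rpos //; have [->] := color_finite rx.
- elim: y ltxy leyk => // y IH ltxy leyk.
  have [_ [_ /andP[/= lty _]]] := @color_finite y.+1 ltac:(lia).
  case: (ltngtP x y) => [lt_xy|?|-> //]; last lia.
  by apply: leq_trans lty; apply: ltnW; apply: IH => //; lia.
- have [v ev] : exists v, v = P y by exists (P y).
  elim: v y ry ev ltP => [|v IH] y ry ev ltP; first lia.
  have rPx := perm321_range HP rx.
  have [rb Pb] := belowP ry ltac:(lia).
  have [_ [/eqP sb _]] := color_finite rb.
  have [_ [_ /andP[_ /andP[_]]]] := color_finite ry.
  rewrite -(color_below color_nofix ry ltac:(lia)).
  (* The candidate of [below y] is suited, which rules out the second alternative in [supported] and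
     leaves the comparison of values. *)
  rewrite /suited sb eqxx orbF => ltT.
  case: (ltngtP (P x) v) => [ltv|?|eqv]; last 1 first.
  - by have -> : x = below y by apply: (perm321_inj HP) => //; lia.
  - by apply: ltn_trans ltT; apply: IH => //; lia.
  - lia.
Qed.

End Readout.

(** Whether [y] is settled depends only on the candidates at [y], [y.-1] and [below y], so an
    advance at [x] can disturb only [x], its right neighbour and the point just above it in
    value. *)
Lemma advance_settled r x c y : (forall c z, ~~ (0 < z <= k) -> r c z = 0) ->
  0 < x <= k -> settled r c y ->
  y != x -> y != x.+1 -> y != inv (P x).+1 -> settled (advance r x) c y.
Proof.
move=> r0 rx set_y neq neqS neqB.
have adv c' z : z != x -> advance r x c' z = r c' z.
  by move=> /negPf ne; rewrite /advance ne addn0.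
case: (boolP (0 < y <= k)) => [ry|nry]; last by rewrite /settled adv // r0.
have rP := perm321_range HP ry.
have neb : below y != x.
  apply/eqP => eb; case: (ltngtP (P y) 1) => [|gt1|eq1]; first lia.
    have [_] := belowP ry gt1; rewrite eb => Px; case/eqP: neqB.
    by rewrite Px prednK ?invK //; lia.
  by move: eb; rewrite /below eq1 inv0; lia.
by rewrite /settled /supported !adv //; lia.
Qed.

End Worklist.

(** * Executing straight-line code *)

(** Quantifying over the remaining fuel makes traces compose, with step counts adding up. *)
Definition runs (P : program) p m t p' m' :=
  forall s, exec (t + s) P p m = exec s P p' m'.

Lemma runs_trans P p1 m1 t1 p2 m2 t2 p3 m3 :
  runs P p1 m1 t1 p2 m2 -> runs P p2 m2 t2 p3 m3 -> runs P p1 m1 (t1 + t2) p3 m3.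
Proof. by move=> r1 r2 s; rewrite -addnA r1 r2. Qed.

Lemma runs_halt P p m t p' m' b :
  runs P p m t p' m' -> nth IHalt P p' = IHalt -> t < b -> exec b P p m = Some m'.
Proof.
move=> r halt ltb; rewrite -(subnKC (ltnW ltb)) r.
have : 0 < b - t by lia.
by case: (b - t) => //= s _; rewrite halt.
Qed.

Fixpoint code_at (P : program) p (c : seq instr) : Prop :=
  if c is i :: c' then nth IHalt P p = i /\ code_at P p.+1 c' else True.

Lemma code_at_cat P p c1 c2 :
  code_at P p (c1 ++ c2) <-> code_at P p c1 /\ code_at P (p + size c1) c2.
Proof.
elim: c1 p => [|i c1 IH] p /=; first by rewrite addn0; tauto.
by rewrite IH addnS addSn; tauto.
Qed.

Lemma code_at_self (P : program) : code_at P 0 P.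
Proof.
suff gen pre c : code_at (pre ++ c) (size pre) c by exact: (gen [::]).
elim: c pre => [|i c IH] pre //=; split; first by rewrite nth_cat ltnn subnn.
by have := IH (rcons pre i); rewrite size_rcons cat_rcons.
Qed.

Definition straight (i : instr) : bool :=
  if i is (IJz _ _ | IJmp _ | IHalt) then false else true.

Definition effect (m : memory) (i : instr) : memory :=
  match i with
  | IConst r c => upd m r c
  | IAdd r a b => upd m r (m a + m b)
  | ISub r a b => upd m r (m a - m b)
  | ILt r a b => upd m r (m a < m b)
  | ILoad r a => upd m r (m (m a))
  | IStore a b => upd m (m a) (m b)
  | _ => m
  end.

Definition effects := foldl effect.

Lemma effects_cat m c1 c2 : effects m (c1 ++ c2) = effects (effects m c1) c2.
Proof. exact: foldl_cat. Qed.

Lemma runs_straight P p m c : all straight c -> code_at P p c ->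
  runs P p m (size c) (p + size c) (effects m c).
Proof.
elim: c p m => [|i c IH] p m /=; first by rewrite addn0.
move=> /andP[si sc] [Pi Pc] s; rewrite addnS -addSn -(IH p.+1 (effect m i) sc Pc s).
by rewrite addSn /= Pi; case: i si {Pi}.
Qed.

Lemma runs_jz P p m a l : nth IHalt P p = IJz a l ->
  runs P p m 1 (if m a == 0 then l else p.+1) m.
Proof. by move=> Pp s; rewrite /= Pp. Qed.

Lemma runs_jmp P p m l : nth IHalt P p = IJmp l -> runs P p m 1 l m.
Proof. by move=> Pp s; rewrite /= Pp. Qed.

Lemma upd_eq m r v : upd m r v r = v.
Proof. by rewrite /upd eqxx. Qed.

Lemma upd_neq m r v x : x != r -> upd m r v x = m x.
Proof. by rewrite /upd => /negPf ->. Qed.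

(** * A while language over sixteen unbounded arrays *)

Inductive binop := OAdd | OSub | OLt.

Inductive expr :=
  | Cst of nat
  | Arr of nat & expr
  | Bin of binop & expr & expr.

Inductive cmd :=
  | Put of nat & expr & expr
  | Seq of cmd & cmd
  | If of expr & cmd
  | While of expr & cmd.

Definition state := nat -> nat -> nat.

Definition put (a : state) j i v : state :=
  fun j' i' => if (j' == j) && (i' == i) then v else a j' i'.

Definition binop_eval o x y : nat :=
  match o with OAdd => x + y | OSub => x - y | OLt => x < y end.

Fixpoint eval (a : state) e : nat :=
  match e with
  | Cst c => c
  | Arr j e => a j (eval a e)
  | Bin o e f => binop_eval o (eval a e) (eval a f)
  end.

(** The length of the compiled code; the 8 is seven instructions of address computation and one
    load. *)
Fixpoint ecost e : nat :=
  match e with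
  | Cst _ => 1
  | Arr _ e => ecost e + 8
  | Bin _ e f => ecost e + (ecost f + 1)
  end.

Fixpoint ccost c : nat :=
  match c with
  | Put _ e f => ecost e + (7 + (ecost f + 1))
  | Seq c d => ccost c + ccost d
  | If e c => ecost e + (1 + ccost c)
  | While e c => ecost e + (1 + (ccost c + 1))
  end.

Inductive run : cmd -> state -> state -> nat -> Prop :=
  | run_put j e f a :
      run (Put j e f) a (put a j (eval a e) (eval a f)) (ccost (Put j e f))
  | run_seq c d a1 a2 a3 t1 t2 :
      run c a1 a2 t1 -> run d a2 a3 t2 -> run (Seq c d) a1 a3 (t1 + t2)
  | run_if_true e c a a' t : eval a e != 0 ->
      run c a a' t -> run (If e c) a a' (ecost e + (1 + t))
  | run_if_false e c a : eval a e = 0 -> run (If e c) a a (ecost e + 1)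
  | run_while_true e c a a' a'' t t' : eval a e != 0 ->
      run c a a' t -> run (While e c) a' a'' t' ->
      run (While e c) a a'' (ecost e + (1 + (t + (1 + t'))))
  | run_while_false e c a : eval a e = 0 -> run (While e c) a a (ecost e + 1).

Fixpoint loopfree c : bool :=
  match c with
  | Put _ _ _ => true
  | Seq c d => loopfree c && loopfree d
  | If _ c => loopfree c
  | While _ _ => false
  end.

Fixpoint ceval c (a : state) : state :=
  match c with
  | Put j e f => put a j (eval a e) (eval a f)
  | Seq c d => ceval d (ceval c a)
  | If e c => if eval a e == 0 then a else ceval c a
  | While _ _ => a
  end.

Lemma run_loopfree c a : loopfree c -> exists2 t, run c a (ceval c a) t & t <= ccost c.
Proof.
elim: c a => [j e f|c IHc d IHd|e c IH|//] a /=.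
- by exists (ccost (Put j e f)) => //; apply: run_put.
- move=> /andP[/(IHc a)[t1 r1 le1] /(IHd (ceval c a))[t2 r2 le2]].
  by exists (t1 + t2); [apply: run_seq r1 r2|apply: leq_add].
- move=> /(IH a)[t r le]; case: (eqVneq (eval a e) 0) => e0.
    by exists (ecost e + 1); [apply: run_if_false|lia].
  by exists (ecost e + (1 + t)); [apply: run_if_true|lia].
Qed.

(** The body runs at most [phi a] times, and the extra unit pays for the final failing test. *)
Lemma run_while (Inv : state -> Prop) (phi : state -> nat) e c a :
  loopfree c ->
  (forall b, Inv b -> eval b e != 0 -> Inv (ceval c b) /\ phi (ceval c b) < phi b) ->
  Inv a ->
  exists a' t, [/\ run (While e c) a a' t, Inv a', eval a' e = 0
                 & t <= ccost (While e c) * (phi a).+1].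
Proof.
move=> lf step; have [N leN] := ubnP (phi a); elim: N a leN => // N IH a leN Ia.
case: (eqVneq (eval a e) 0) => e0.
  by exists a, (ecost e + 1); split=> //; [apply: run_while_false|rewrite /=; lia].
have [Ib ltb] := step a Ia e0; have [t r le] := run_loopfree a lf.
have [|a' [t' [r' Ia' e0' le']]] := IH (ceval c a) _ Ib; first lia.
exists a', (ecost e + (1 + (t + (1 + t')))); split=> //; first exact: run_while_true r r'.
by rewrite mulnS; move: le' => /=; nia.
Qed.

(** * Compilation to the RAM *)

(* Cell 0 holds the base address B, cells 1 to 31 are temporaries, and element i of
   array j lives in cell B + 16 i + j. *)

Definition addr_code j d : seq instr :=
  nseq 4 (IAdd d d d) ++ [:: IConst d.+1 j; IAdd d d d.+1; IAdd d d 0].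

Definition binop_code o d : instr :=
  match o with
  | OAdd => IAdd d d d.+1 | OSub => ISub d d d.+1 | OLt => ILt d d d.+1
  end.

Fixpoint ecode e d : seq instr :=
  match e with
  | Cst c => [:: IConst d c]
  | Arr j e => ecode e d ++ addr_code j d ++ [:: ILoad d d]
  | Bin o e f => ecode e d ++ ecode f d.+1 ++ [:: binop_code o d]
  end.

Fixpoint ccode c p : seq instr :=
  match c with
  | Put j e f => ecode e 1 ++ addr_code j 1 ++ ecode f 2 ++ [:: IStore 1 2]
  | Seq c d => ccode c p ++ ccode d (p + ccost c)
  | If e c => ecode e 1 ++ IJz 1 (p + ccost (If e c)) :: ccode c (p + (ecost e + 1))
  | While e c =>
      ecode e 1 ++ IJz 1 (p + ccost (While e c)) ::
      ccode c (p + (ecost e + 1)) ++ [:: IJmp p]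
  end.

Fixpoint ewf e d : bool :=
  match e with
  | Cst _ => d < 32
  | Arr j e => [&& j < 16, d.+1 < 32 & ewf e d]
  | Bin _ e f => ewf e d && ewf f d.+1
  end.

Fixpoint cwf c : bool :=
  match c with
  | Put j e f => [&& j < 16, ewf e 1 & ewf f 2]
  | Seq c d => cwf c && cwf d
  | If e c | While e c => ewf e 1 && cwf c
  end.

Lemma ecode_Arr j e d :
  ecode (Arr j e) d = ecode e d ++ addr_code j d ++ [:: ILoad d d].
Proof. by []. Qed.

Lemma ccode_Put j e f p :
  ccode (Put j e f) p = ecode e 1 ++ addr_code j 1 ++ ecode f 2 ++ [:: IStore 1 2].
Proof. by []. Qed.

Lemma size_ecode e d : size (ecode e d) = ecost e.
Proof.
elim: e d => [//|j e IH|o e IHe f IHf] d /=; first by rewrite size_cat IH.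
by rewrite !size_cat IHe IHf.
Qed.

Lemma size_ccode c p : size (ccode c p) = ccost c.
Proof.
elim: c p => [j e f|c IHc d IHd|e c IH|e c IH] p /=; rewrite ?(size_cat, size_ecode) //=.
- by rewrite size_cat size_ecode.
- by rewrite IHc IHd.
- by rewrite IH.
- by rewrite size_cat IH.
Qed.

Lemma straight_ecode e d : all straight (ecode e d).
Proof.
elim: e d => [//|j e IH|o e IHe f IHf] d /=; rewrite !all_cat ?IH ?IHe ?IHf //.
by case: o.
Qed.

Definition represents B (m : memory) (a : state) :=
  m 0 = B /\ forall i j, j < 16 -> m (B + (16 * i + j)) = a j i.

(** The four doublings multiply by 16, the stride of the interleaved arrays. *)
Lemma addr_code_spec B m j d : m 0 = B -> 0 < d ->
  let m' := effects m (addr_code j d) in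
  m' d = B + (16 * m d + j) /\ forall x, x != d -> x != d.+1 -> m' x = m x.
Proof.
move=> m0 d0; rewrite /addr_code /=; split=> [|x nd nS]; last by rewrite !upd_neq.
have [h1 h2 h3] : [/\ d != d.+1, 0 != d & 0 != d.+1] by split; lia.
rewrite !(upd_eq, @upd_neq _ _ _ _ h1, @upd_neq _ _ _ _ h2, @upd_neq _ _ _ _ h3) m0; lia.
Qed.

(** The cells from [d] on act as an evaluation stack: the frame keeps a left operand in [d] alive
    while the right one is evaluated, and keeps the heap intact as [32 <= B]. *)
Lemma ecode_spec B a e d m : 32 <= B -> 0 < d -> ewf e d -> represents B m a ->
  let m' := effects m (ecode e d) in
  m' d = eval a e /\ forall x, (x < d) || (32 <= x) -> m' x = m x.
Proof.
move=> leB; elim: e d m => [c|j e IH|o e IHe f IHf] d m d0.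
- move=> /= ltd _; rewrite upd_eq; split=> // x xd; rewrite upd_neq //; lia.
- move=> /and3P[j16 dS we] rep; rewrite ecode_Arr effects_cat.
  have [] := IH d m d0 we rep; set m1 := effects m _ => m1d m1x.
  have m10 : m1 0 = B by rewrite m1x ?d0 // (proj1 rep).
  have [m2d m2x] := addr_code_spec j m10 d0.
  rewrite effects_cat; set m2 := effects m1 _ in m2d m2x *.
  rewrite /= upd_eq; split=> [|x xd].
    by rewrite m2d m1d m2x ?m1x ?(proj2 rep) //; lia.
  by rewrite upd_neq ?m2x ?m1x //; lia.
- move=> /= /andP[we wf] rep; rewrite effects_cat.
  have [] := IHe d m d0 we rep; set m1 := effects m _ => m1d m1x.
  have rep1 : represents B m1 a.
    split=> [|i j j16]; first by rewrite m1x ?d0 // (proj1 rep).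
    by rewrite m1x ?(proj2 rep) //; lia.
  have [] := IHf d.+1 m1 isT wf rep1; rewrite effects_cat; set m2 := effects m1 _ => m2d m2x.
  have m2d' : m2 d = eval a e by rewrite m2x ?ltnSn.
  have d32 : d < 32.
    by elim: e d we {IHe m d0 rep m1 m1d m1x rep1 wf IHf m2 m2d m2x m2d'} => //=;
       [move=> ? e IH d /and3P[_ _]; apply: IH|move=> ? e IH ? _ d /andP[/IH]].
  split; first by case: o; rewrite /= upd_eq m2d m2d'.
  move=> x xd; have -> : effects m2 [:: binop_code o d] x = m2 x.
    by case: o => /=; rewrite upd_neq //; lia.
  by rewrite m2x ?m1x //; lia.
Qed.

Lemma represents_ecode B a e d m : 32 <= B -> 0 < d -> ewf e d -> represents B m a ->
  represents B (effects m (ecode e d)) a.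
Proof.
move=> leB d0 we rep; have [_ frame] := ecode_spec leB d0 we rep.
split=> [|i j j16]; first by rewrite frame ?d0 // (proj1 rep).
by rewrite frame ?(proj2 rep) //; lia.
Qed.

Lemma put_spec B a j e f m : 32 <= B -> cwf (Put j e f) -> represents B m a ->
  represents B (effects m (ccode (Put j e f) 0)) (put a j (eval a e) (eval a f)).
Proof.
move=> leB /and3P[j16 we wf] rep.
rewrite ccode_Put !effects_cat.
have [m1d m1x] := ecode_spec leB (ltn0Sn 0) we rep.
have [m10 rep1] := represents_ecode leB (ltn0Sn 0) we rep.
set m1 := effects m _ in m1d m1x m10 rep1 *.
have [m2d m2x] := addr_code_spec j m10 (ltn0Sn 0).
set m2 := effects m1 _ in m2d m2x *.
have rep2 : represents B m2 a.
  split=> [|i j' j'16]; first by rewrite m2x.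
  by rewrite m2x ?rep1 //; lia.
have [m3d m3x] := ecode_spec leB (ltn0Sn 1) wf rep2.
have [m30 rep3] := represents_ecode leB (ltn0Sn 1) wf rep2.
set m3 := effects m2 _ in m3d m3x m30 rep3 *.
rewrite [effects m3 _]/= m3x // m2d m3d m1d; split=> [|i j' j'16].
  by rewrite upd_neq //; lia.
rewrite /put; case: ifP => [/andP[/eqP-> /eqP->]|ne]; first by rewrite upd_eq.
(* Both array indices are below 16, so distinct elements have distinct addresses. *)
rewrite upd_neq ?rep3 //; apply/negP => /eqP eqa; move/negP: ne; apply.
by apply/andP; split; apply/eqP; lia.
Qed.

Lemma ccode_correct (P : program) B c a a' t : run c a a' t ->
  forall p m, 32 <= B -> cwf c -> code_at P p (ccode c p) -> represents B m a ->
  exists2 m', runs P p m t (p + ccost c) m' & represents B m' a'.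
Proof.
elim=> {c a a' t}.
- move=> j e f a p m leB wf at_p rep.
  exists (effects m (ccode (Put j e f) 0)); last exact: put_spec.
  rewrite -(size_ccode (Put j e f) p); apply: runs_straight => //.
  by rewrite ccode_Put !all_cat !straight_ecode.
- move=> c d a1 a2 a3 t1 t2 _ IHc _ IHd p m leB /= /andP[wc wd].
  rewrite code_at_cat size_ccode => -[at_c at_d] rep.
  have [m2 r2 rep2] := IHc p m leB wc at_c rep.
  have [m3 r3 rep3] := IHd _ m2 leB wd at_d rep2.
  by exists m3 => //; rewrite addnA; apply: runs_trans r2 r3.
- move=> e c a a' t e0 _ IH p m leB /= /andP[we wc].
  rewrite code_at_cat size_ecode => -[at_e /= [Pj at_c]] rep.
  have re := @runs_straight P p m _ (straight_ecode e 1) at_e.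
  have [m1d _] := ecode_spec leB (ltn0Sn 0) we rep.
  have rep1 := represents_ecode leB (ltn0Sn 0) we rep.
  have rj := runs_jz (effects m (ecode e 1)) Pj; rewrite m1d (negPf e0) in rj.
  have eqp : (p + ecost e).+1 = p + (ecost e + 1) by lia.
  rewrite eqp in at_c rj.
  have [|m2 r2 rep2] := IH (p + (ecost e + 1)) _ leB wc _ rep1.
    exact: at_c.
  exists m2 => //; rewrite size_ecode in re; apply: runs_trans re _; apply: runs_trans rj _.
  by move: r2; rewrite -!addnA.
- move=> e c a e0 p m leB /= /andP[we wc].
  rewrite code_at_cat size_ecode => -[at_e /= [Pj at_c]] rep.
  have re := @runs_straight P p m _ (straight_ecode e 1) at_e.
  have [m1d _] := ecode_spec leB (ltn0Sn 0) we rep.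
  have rep1 := represents_ecode leB (ltn0Sn 0) we rep.
  have rj := runs_jz (effects m (ecode e 1)) Pj; rewrite m1d e0 eqxx in rj.
  by eexists; [rewrite size_ecode in re; apply: runs_trans re rj|].
- move=> e c a a' a'' t t' e0 _ IHc _ IHw p m leB /= wec; case/andP: (wec) => we wc.
  move=> at_w; move: (at_w).
  rewrite code_at_cat size_ecode => -[at_e /= [Pj]].
  rewrite code_at_cat size_ccode /= => -[at_c [Pm _]] rep.
  have re := @runs_straight P p m _ (straight_ecode e 1) at_e.
  have [m1d _] := ecode_spec leB (ltn0Sn 0) we rep.
  have rep1 := represents_ecode leB (ltn0Sn 0) we rep.
  have rj := runs_jz (effects m (ecode e 1)) Pj; rewrite m1d (negPf e0) in rj.
  have eqp : (p + ecost e).+1 = p + (ecost e + 1) by lia.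
  rewrite eqp in at_c rj.
  have [|m2 r2 rep2] := IHc (p + (ecost e + 1)) _ leB wc _ rep1.
    exact: at_c.
  have rm := runs_jmp m2 Pm.
  have [m3 r3 rep3] := IHw p m2 leB wec at_w rep2.
  exists m3 => //; rewrite size_ecode in re; apply: runs_trans re _; apply: runs_trans rj _.
  by apply: runs_trans r2 _; rewrite -eqp; apply: runs_trans rm r3.
- move=> e c a e0 p m leB /= /andP[we wc].
  rewrite code_at_cat size_ecode => -[at_e /= [Pj at_c]] rep.
  have re := @runs_straight P p m _ (straight_ecode e 1) at_e.
  have [m1d _] := ecode_spec leB (ltn0Sn 0) we rep.
  have rep1 := represents_ecode leB (ltn0Sn 0) we rep.
  have rj := runs_jz (effects m (ecode e 1)) Pj; rewrite m1d e0 eqxx in rj.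
  by eexists; [rewrite size_ecode in re; apply: runs_trans re rj|].
Qed.

(** * Relocating the input *)

(** Cell 2 is parked at address [B] to free it for the stride 16; once cell 3 has been moved, it
    carries the parked value to its slot [B + 32]. *)
Definition save_low : seq instr :=
  [:: IStore 0 1; IAdd 1 0 0; IStore 1 2; IConst 2 16; IAdd 1 1 2; IAdd 1 1 2;
      IAdd 1 1 2; IStore 1 3; IAdd 3 0 0; ILoad 3 3; ISub 1 1 2; IStore 1 3; IAdd 1 1 2].

Definition save_cell j : seq instr := [:: IAdd 1 1 2; IStore 1 j].

(** Cells 4 to 31 are moved by unrolled code and only afterwards serve as registers for a loop. *)
Definition save_rest : seq instr := flatten [seq save_cell j | j <- iota 4 28].

Definition restore_sizes : seq instr :=
  [:: ILoad 3 0; IConst 4 0; IAdd 4 4 0] ++ nseq 40 (ISub 4 4 3) ++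
  [:: IAdd 5 0 0; IStore 5 4; IAdd 5 5 2; IStore 5 3; IConst 6 32; IConst 7 1].

Definition copy_cell : seq instr :=
  [:: IAdd 1 1 2; ILoad 8 6; IStore 1 8; IAdd 6 6 7; ILt 8 6 0].

Definition copy_loop q : seq instr := copy_cell ++ [:: IJz 8 (q + 7); IJmp q].

(* The input fills all low cells, so the only scratch space is cells 0 and 1 and their
   contents n and k must survive.  Cell 0 becomes A = n + 40 k, an address past the input
   under which k is stored; n is recovered from A and k, and B = 2 A is the heap base. *)
Definition preload : seq instr :=
  nseq 40 (IAdd 0 0 1) ++ save_low ++ save_rest ++ restore_sizes.

Definition loader p : seq instr :=
  preload ++ copy_loop (p + size preload) ++ [:: IAdd 0 0 0].

Lemma effects_cons m i c : effects m (i :: c) = effects (effect m i) c.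
Proof. by []. Qed.

Lemma effects_nseq_add c r s m : r != s ->
  let m' := effects m (nseq c (IAdd r r s)) in
  m' r = m r + c * m s /\ forall x, x != r -> m' x = m x.
Proof.
move=> rs; elim: c m => [|c IH] m /=; first by rewrite addn0.
have [-> frame] := IH (effect m (IAdd r r s)).
rewrite /= upd_eq upd_neq 1?eq_sym //; split=> [|x xr]; first lia.
by rewrite frame //= upd_neq.
Qed.

Lemma effects_nseq_sub c r s m : r != s ->
  let m' := effects m (nseq c (ISub r r s)) in
  m' r = m r - c * m s /\ forall x, x != r -> m' x = m x.
Proof.
move=> rs; elim: c m => [|c IH] m /=; first by rewrite subn0.
have [-> frame] := IH (effect m (ISub r r s)).
rewrite /= upd_eq upd_neq 1?eq_sym //; split=> [|x xr]; first lia.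
by rewrite frame //= upd_neq.
Qed.

Ltac upd_simpl :=
  repeat (rewrite upd_eq ||
    match goal with |- context [upd ?m ?r ?v ?x] => rewrite (@upd_neq m r v x); [|lia] end).

Section Loader.

Variables (init : memory) (n k : nat).
Hypotheses (n_gt0 : 0 < n) (k_gt0 : 0 < k) (init0 : init 0 = n) (init1 : init 1 = k).
Hypothesis (init_out : forall y, n + k + 2 <= y -> init y = 0).

Variables A B : nat.
Hypotheses (A_def : A = n + 40 * k) (AB : B = A + A).

(** The factor 40 puts [A] beyond the 32 low cells even when [n = k = 1]. *)
Lemma A_gt40 : 40 < A.
Proof. by rewrite A_def; lia. Qed.

Lemma A_out : n + k + 2 <= A.
Proof. by rewrite A_def; lia. Qed.

(* The slots of array 0 below [lo] are still unspecified. *)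
Definition moved lo a (m : memory) :=
  forall i j, j < 16 -> (j != 0) || (lo <= i) ->
  m (B + (16 * i + j)) = if (j == 0) && (i < a) then init i else 0.

Definition loaded a (m : memory) :=
  [/\ m 0 = A, m 1 = B + 16 * a.-1, m 2 = 16 & forall y, a <= y < A -> m y = init y].

Lemma moved_upd lo a m : moved lo a m ->
  moved lo a.+1 (upd m (B + 16 * a) (init a)).
Proof.
move=> mv i j j16 lo_i; rewrite /upd; case: eqP => [eqa|ne].
  have [-> ->] : j = 0 /\ i = a by lia.
  by rewrite ltnSn.
rewrite mv //; case: (eqVneq j 0) => //= j0.
by have -> : (i < a.+1) = (i < a) by lia.
Qed.

Lemma moved_low lo a m r v : r < B -> moved lo a m -> moved lo a (upd m r v).
Proof. by move=> rB mv i j j16 lo_i; rewrite upd_neq ?mv //; lia. Qed.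

Lemma save_low_spec m : m 0 = A -> (forall x, x != 0 -> m x = init x) ->
  let m' := effects m save_low in [/\ loaded 4 m', moved 2 4 m' & m' A = k].
Proof.
have A41 := A_gt40.
have Aout := A_out.
have [e1 e2 e3] : [/\ B + 16 + 16 = B + 32, B + 32 + 16 = B + 48 & B + 48 - 16 = B + 32].
  by split; lia.
move=> m0 mx; rewrite /save_low.
do 13 (rewrite effects_cons /effect; upd_simpl;
  rewrite ?m0 ?(mx 1) ?(mx 2) ?(mx 3) ?init1 // -?AB ?e1 ?e2 ?e3).
move=> /=; split; last by upd_simpl.
  split; upd_simpl => //.
  by move=> y ry; upd_simpl; rewrite mx //; lia.
move=> i j j16 ij; case: (boolP ((j == 0) && (i < 4))) => [/andP[/eqP j0 lt4]|not4].
  have [->|->] : i = 2 \/ i = 3 by lia.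
    by rewrite j0 (_ : B + (16 * 2 + 0) = B + 32) //; upd_simpl.
  by rewrite j0 (_ : B + (16 * 3 + 0) = B + 48) //; upd_simpl.
by upd_simpl; rewrite mx ?init_out //; lia.
Qed.

Lemma save_cell_spec a m : 4 <= a < 32 -> loaded a m -> moved 2 a m -> m A = k ->
  let m' := effects m (save_cell a) in [/\ loaded a.+1 m', moved 2 a.+1 m' & m' A = k].
Proof.
have A41 := A_gt40.
move=> ra [m0 m1 m2 mx] mv mA; rewrite /save_cell.
rewrite effects_cons /effect m1 m2 (_ : B + 16 * a.-1 + 16 = B + 16 * a); last lia.
rewrite effects_cons /effect; upd_simpl; rewrite mx; last lia.
have mv' : moved 2 a (upd m 1 (B + 16 * a)) by apply: moved_low => //; lia.
split; [|exact: moved_upd|by rewrite /=; upd_simpl].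
by split; rewrite /=; upd_simpl => // y ry; upd_simpl; apply: mx; lia.
Qed.

Lemma save_rest_spec m : loaded 4 m -> moved 2 4 m -> m A = k ->
  let m' := effects m save_rest in [/\ loaded 32 m', moved 2 32 m' & m' A = k].
Proof.
suff gen c a m1 : 4 <= a -> a + c <= 32 -> loaded a m1 -> moved 2 a m1 -> m1 A = k ->
  let m' := effects m1 (flatten [seq save_cell j | j <- iota a c]) in
  [/\ loaded (a + c) m', moved 2 (a + c) m' & m' A = k] by exact: (gen 28).
elim: c a m1 => [|c IH] a m1 lea lec ld mv mA; first by rewrite addn0.
rewrite -[flatten _]/(save_cell a ++ flatten [seq save_cell j | j <- iota a.+1 c]) effects_cat.
have [|ld' mv' mA'] := save_cell_spec _ ld mv mA; first lia.
by rewrite -addSnnS; apply: IH => //; lia.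
Qed.

Lemma restore_sizes_spec m : loaded 32 m -> moved 2 32 m -> m A = k ->
  let m' := effects m restore_sizes in
  [/\ loaded 32 m', moved 0 32 m', m' 6 = 32 & m' 7 = 1].
Proof.
have A41 := A_gt40.
have An : A - 40 * k = n by rewrite A_def; lia.
move=> [m0 m1 m2 mx] mv mA; rewrite /restore_sizes effects_cat.
do 3 (rewrite effects_cons /effect; upd_simpl; rewrite ?m0 ?mA ?add0n).
rewrite [effects _ [::]]/= effects_cat; set m3 := upd _ 4 A.
have [m4d m4x] := @effects_nseq_sub 40 4 3 m3 isT.
move: (effects m3 _) m4d m4x => m4 m4d m4x.
have m43 : m4 3 = k by rewrite m4x // /m3; upd_simpl.
have {m4d} m44 : m4 4 = n by rewrite m4d /m3; upd_simpl.
have m4E x : x != 4 -> x != 3 -> m4 x = m x.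
  by move=> x4 x3; rewrite m4x // /m3; upd_simpl.
do 6 (rewrite effects_cons /effect; upd_simpl; rewrite ?m43 ?m44 ?(m4E 0) ?(m4E 2) ?m0 ?m2 // -?AB).
rewrite [effects _ [::]]/=; split; upd_simpl => //.
  split; upd_simpl; rewrite ?m4E // => y ry.
  by upd_simpl; rewrite m4E ?mx //; lia.
move=> i j j16 _; case: (boolP ((j == 0) && (i < 2))) => [/andP[/eqP j0 lt2]|ge2].
  have [->|->] : i = 0 \/ i = 1 by lia.
    by rewrite j0 muln0 !addn0; upd_simpl; rewrite init0.
  by rewrite j0 (_ : B + (16 * 1 + 0) = B + 16) //; upd_simpl; rewrite init1.
by upd_simpl; rewrite m4E ?mv //; lia.
Qed.

Lemma copy_loop_spec P q a m : code_at P q (copy_loop q) -> 32 <= a < A ->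
  loaded a m -> moved 0 a m -> m 6 = a -> m 7 = 1 ->
  exists m', [/\ runs P q m (7 * (A - a).-1 + 6) (q + 7) m', m' 0 = A & moved 0 A m'].
Proof.
have A41 := A_gt40.
move=> Pq; move: (Pq); rewrite code_at_cat => -[at_c /= [Pj [Pm _]]].
have [d ed] : exists d, d = A - a by exists (A - a).
elim: d a m ed => [|d IH] a m ed ra [m0 m1 m2 mx] mv m6 m7; first lia.
have ma : m a = init a by apply: mx; lia.
have := @runs_straight P q m copy_cell isT at_c.
rewrite /copy_cell effects_cons /effect m1 m2 (_ : B + 16 * a.-1 + 16 = B + 16 * a); last lia.
do 4 (rewrite effects_cons /effect; upd_simpl; rewrite ?m0 ?m6 ?m7 ?addn1; upd_simpl; rewrite ?ma).
rewrite [effects _ [::]]/= [size _]/=; set m5 := upd _ 8 _ => r5.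
have mv5 : moved 0 a.+1 m5.
  apply: moved_low; first lia.
  apply: moved_low; first lia.
  by apply: moved_upd; apply: moved_low; [lia|apply: moved_low => //; lia].
have m58 : m5 8 = (a.+1 < A) by rewrite /m5; upd_simpl.
have m50 : m5 0 = A by rewrite /m5; upd_simpl.
have rj := runs_jz m5 Pj.
have r6 := runs_trans r5 rj; rewrite m58 in r6.
case: (ltnP a.+1 A) => [lta|gea]; last first.
  rewrite ltnNge gea /= in r6; have eA : a.+1 = A by lia.
  by exists m5; split=> //; rewrite -?eA // (_ : 7 * _ + 6 = 5 + 1) //; lia.
rewrite lta /= in r6.
have r7 := runs_trans r6 (runs_jmp m5 Pm).
have [||||||m' [r' m'0 mv']] := IH a.+1 m5 => //; try lia.
- split=> //; rewrite /m5; upd_simpl => //= y ry; upd_simpl; apply: mx; lia.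
- by rewrite /m5; upd_simpl.
exists m'; split=> //; have := runs_trans r7 r'.
by rewrite (_ : 5 + 1 + 1 + _ = 7 * (A - a).-1 + 6) //; lia.
Qed.

Lemma loader_spec P p : code_at P p (loader p) ->
  exists m' t, [/\ runs P p init t (p + size (loader p)) m',
    represents B m' (fun j i => if j == 0 then init i else 0), 32 <= B
    & t <= size preload + 7 * A].
Proof.
have A41 := A_gt40.
have Aout := A_out.
move=> /code_at_cat[at_p /code_at_cat[at_l [Pe _]]].
have := @runs_straight P p init preload isT at_p.
have -> : effects init preload = effects (effects (effects (effects init
    (nseq 40 (IAdd 0 0 1))) save_low) save_rest) restore_sizes.
  by rewrite -!effects_cat -!catA.
have [] := @effects_nseq_add 40 0 1 init isT.
move: (effects init _) => m1; rewrite init0 init1 -A_def => m10 m1x.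
have [ld2 mv2 m2A] := save_low_spec m10 m1x.
move: (effects m1 _) ld2 mv2 m2A => m2 ld2 mv2 m2A.
have [ld3 mv3 m3A] := save_rest_spec ld2 mv2 m2A.
move: (effects m2 _) ld3 mv3 m3A => m3 ld3 mv3 m3A.
have [ld4 mv4 m46 m47] := restore_sizes_spec ld3 mv3 m3A.
move: (effects m3 _) ld4 mv4 m46 m47 => m4 ld4 mv4 m46 m47 r4.
have [|m5 [r5 m50 mv5]] := copy_loop_spec at_l _ ld4 mv4 m46 m47; first lia.
have r6 := @runs_straight P _ m5 [:: IAdd 0 0 0] isT (conj Pe I).
have := runs_trans (runs_trans r4 r5) r6; rewrite [effects m5 _]/= m50 => r7.
exists (upd m5 0 B), (size preload + (7 * (A - 32).-1 + 6) + 1); split; [| |lia|lia].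
  suff -> : p + size (loader p) = p + size preload + 7 + 1 by rewrite AB.
  by rewrite /loader 2!size_cat !addnA.
split=> [|i j j16]; first by rewrite upd_eq.
rewrite upd_neq ?mv5 ?orbT //; last lia.
case: (eqVneq j 0) => //= _; case: ltnP => // leA.
by rewrite init_out //; lia.
Qed.

End Loader.

(** * The matching program *)

(* Arrays: 0 the input, 1 the inverse of the pattern, 2 and 3 the candidate positions for
   the two colours, 4 the stack; the scalars are n = 5[0], k = 6[0], the current point
   7[0], the stack height 8[0], two flags 9[0] and 10[0], and the answer 11[0]. *)

Definition var j := Arr j (Cst 0).
Notation eadd := (Bin OAdd).
Notation esub := (Bin OSub).
Notation elt := (Bin OLt).
Local Notation "c ;; d" := (Seq c d) (at level 85, right associativity).

Definition enot e := esub (Cst 1) e.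
Definition eand e f := elt (Cst 1) (eadd e f).
Definition eor e f := elt (Cst 0) (eadd e f).
Definition eeqb e f := enot (eadd (esub e f) (esub f e)).

Definition ex := var 7.
Definition eT e := Arr 0 (eadd (Cst 1) e).
Definition eP e := Arr 0 (eadd (var 5) (eadd (Cst 1) e)).
Definition eR (c : bool) e := Arr (2 + c) e.
Definition ebelow := Arr 1 (esub (eP ex) (Cst 1)).
Definition esuited (c : bool) x t := eeqb (elt (eT t) t) (elt (eP x) (eadd x (Cst c))).
Definition esupported (c : bool) t :=
  eand (elt (eR c (esub ex (Cst 1))) t)
   (eand (elt (eR c ebelow) (eadd (var 5) (Cst 1)))
     (eor (elt (eT (eR c ebelow)) (eT t)) (enot (esuited c ebelow (eR c ebelow))))).
Definition efixed := esub (elt (eP ex) (eadd ex (Cst 1))) (elt (eP ex) ex).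
Definition esettled (c : bool) :=
  eor (elt (eR c ex) (Cst 1)) (eor (elt (var 5) (eR c ex))
   (eand (esuited c ex (eR c ex))
     (eor (esupported c (eR c ex)) (eand efixed (esupported (~~ c) (eR c ex)))))).

(** [T t] is read from cell [t.+1] of the input, so clearing cell 1, after [k] is saved, makes
    [T 0 = 0] as the virtual points require. *)
Definition prelude :=
  Put 5 (Cst 0) (Arr 0 (Cst 0)) ;; Put 6 (Cst 0) (Arr 0 (Cst 1)) ;;
  Put 0 (Cst 1) (Cst 0) ;; Put 7 (Cst 0) (var 6).

Definition init_body :=
  Put 1 (eP ex) ex ;; Put 2 ex (Cst 1) ;; Put 3 ex (Cst 1) ;;
  Put 4 (esub ex (Cst 1)) ex ;; Put 7 (Cst 0) (esub ex (Cst 1)).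

Definition pop := Put 8 (Cst 0) (esub (var 8) (Cst 1)) ;; Put 7 (Cst 0) (Arr 4 (var 8)).
(** Both flags are computed before any candidate moves, so the two colours advance from the same
    state, as in [advance]. *)
Definition test := Put 9 (Cst 0) (enot (esettled false)) ;; Put 10 (Cst 0) (enot (esettled true)).
Definition bump := Put 2 ex (eadd (Arr 2 ex) (var 9)) ;; Put 3 ex (eadd (Arr 3 ex) (var 10)).
Definition push e := Put 4 (var 8) e ;; Put 8 (Cst 0) (eadd (var 8) (Cst 1)).
(** These are the points that [advance_settled] leaves in doubt. The last two may be virtual, [k.+1]
    or 0; such points have candidate 0 and are settled. *)
Definition repush := If (eadd (var 9) (var 10))
  (push ex ;; push (eadd ex (Cst 1)) ;; push (Arr 1 (eadd (eP ex) (Cst 1)))).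
Definition main_body := pop ;; test ;; bump ;; repush.

Definition answer := Put 11 (Cst 0)
  (eor (elt (Arr 2 (var 6)) (eadd (var 5) (Cst 1))) (elt (Arr 3 (var 6)) (eadd (var 5) (Cst 1)))).

Definition matcher :=
  prelude ;; While ex init_body ;; Put 8 (Cst 0) (var 6) ;; While (var 8) main_body ;; answer.

Lemma cwf_matcher : cwf matcher.
Proof. by []. Qed.

Lemma eval_not a e (b : bool) : eval a e = b -> eval a (enot e) = ~~ b.
Proof. by move=> /= ->; case: b. Qed.

Lemma eval_and a e f (b c : bool) : eval a e = b -> eval a f = c -> eval a (eand e f) = b && c.
Proof. by move=> /= -> ->; case: b; case: c. Qed.

Lemma eval_or a e f (b c : bool) : eval a e = b -> eval a f = c -> eval a (eor e f) = b || c.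
Proof. by move=> /= -> ->; case: b; case: c. Qed.

Lemma eval_eqb a e f (b c : bool) :
  eval a e = b -> eval a f = c -> eval a (eeqb e f) = (b == c).
Proof. by move=> /= -> ->; case: b; case: c. Qed.

Lemma settled_ext n T P inv r r' c x : (forall c y, r c y = r' c y) ->
  settled n T P inv r c x = settled n T P inv r' c x.
Proof. by move=> rr'; rewrite /settled /supported !rr'. Qed.

Section Matcher.

Variables (n k : nat) (input inv : nat -> nat).

Let T t := input t.+1.
Let P x := input (n + x.+1).

Definition candidates (a : state) (c : bool) := a (2 + c).

Definition env (a : state) := (forall y, a 0 y = input y) /\ a 5 0 = n.

Lemma eval_eT a e : env a -> eval a (eT e) = T (eval a e).
Proof. by move=> [a0 _] /=; rewrite a0. Qed.

Lemma eval_eP a e : env a -> eval a (eP e) = P (eval a e).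
Proof. by move=> [a0 a5] /=; rewrite a0 a5. Qed.

Lemma eval_suited a c x t : env a ->
  eval a (esuited c x t) = suited T P c (eval a x) (eval a t).
Proof.
move=> ea; apply: eval_eqb.
  by rewrite -[LHS]/(nat_of_bool (eval a (eT t) < eval a t)) eval_eT.
by rewrite -[LHS]/(nat_of_bool (eval a (eP x) < eval a x + c)) eval_eP.
Qed.

Lemma eval_below a : env a -> (forall v, a 1 v = inv v) -> eval a ebelow = below P inv (a 7 0).
Proof.
move=> ea a1; rewrite -[LHS]/(a 1 (eval a (eP ex) - 1)) eval_eP // a1 subn1.
by [].
Qed.

Lemma eval_supported a c t : env a -> (forall v, a 1 v = inv v) ->
  eval a (esupported c t) = supported n T P inv (candidates a) c (a 7 0) (eval a t).
Proof.
move=> ea a1; have eb := eval_below ea a1.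
have er : eval a (eR c ebelow) = candidates a c (below P inv (a 7 0)) by rewrite -eb.
apply: eval_and; first by rewrite /= subn1.
apply: eval_and; first by rewrite -er /= (proj2 ea) addn1.
apply: eval_or; last by apply: eval_not; rewrite eval_suited // er eb.
by rewrite -[LHS]/(nat_of_bool (eval a (eT (eR c ebelow)) < eval a (eT t))) !eval_eT // er.
Qed.

Lemma eval_settled a c : env a -> (forall v, a 1 v = inv v) ->
  eval a (esettled c) = settled n T P inv (candidates a) c (a 7 0).
Proof.
move=> ea a1; apply: eval_or; first by rewrite /= ltnS leqn0.
apply: eval_or; first by rewrite /= (proj2 ea).
apply: eval_and; first by rewrite eval_suited.
apply: eval_or; first by rewrite eval_supported.
apply: eval_and; last by rewrite eval_supported.
rewrite -[LHS]/((eval a (eP ex) < a 7 0 + 1) - (eval a (eP ex) < a 7 0)) eval_eP //.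
by rewrite -[eval a ex]/(a 7 0); lia.
Qed.

Lemma pop_spec a : let a' := ceval pop a in
  [/\ a' 8 0 = (a 8 0).-1, a' 7 0 = a 4 (a 8 0).-1
    & forall j i, (j \notin [:: 7; 8]) -> a' j i = a j i].
Proof.
split; rewrite /= /put /= ?subn1 // => j i; rewrite !inE => /norP[/negPf-> /negPf->].
by [].
Qed.

Lemma test_spec a : env a -> (forall v, a 1 v = inv v) -> let a' := ceval test a in
  [/\ a' 9 0 = ~~ settled n T P inv (candidates a) false (a 7 0),
      a' 10 0 = ~~ settled n T P inv (candidates a) true (a 7 0)
    & forall j i, (j \notin [:: 9; 10]) -> a' j i = a j i].
Proof.
move=> ea a1; rewrite -[ceval test a]/(ceval (Put 10 (Cst 0) (enot (esettled true)))
   (ceval (Put 9 (Cst 0) (enot (esettled false))) a)).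
set a9 := ceval (Put 9 _ _) a.
have E9 j i : j != 9 -> a9 j i = a j i by move=> /negPf j9; rewrite /a9 /= /put j9.
have a90 : a9 9 0 = ~~ settled n T P inv (candidates a) false (a 7 0).
  by rewrite -(eval_not (eval_settled false ea a1)).
move: a9 E9 a90 => a9 E9 a90.
have e9 : env a9 by split=> [y|]; rewrite E9 // ; [apply: (proj1 ea)|apply: (proj2 ea)].
have s9 : eval a9 (enot (esettled true)) = ~~ settled n T P inv (candidates a) true (a 7 0).
  rewrite (eval_not (eval_settled true e9 _)) => [|v]; last by rewrite E9.
  rewrite E9 //; congr (nat_of_bool (~~ _)); apply: settled_ext => c y.
  by rewrite /candidates E9 //; case: c.
split=> [||j i]; [by rewrite -a90| by rewrite -s9|].
rewrite !inE => /norP[j9 j10].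
by rewrite -[LHS]/(put a9 10 0 _ j i) /put (negPf j10) E9.
Qed.

Lemma bump_spec a : let a' := ceval bump a in
  [/\ forall y, a' 2 y = a 2 y + (if y == a 7 0 then a 9 0 else 0),
      forall y, a' 3 y = a 3 y + (if y == a 7 0 then a 10 0 else 0)
    & forall j i, (j \notin [:: 2; 3]) -> a' j i = a j i].
Proof.
split=> [y|y|j i]; rewrite /= /put /=.
- by case: eqP => [->|_] //; rewrite addn0.
- by case: eqP => [->|_] //; rewrite addn0.
- by rewrite !inE => /norP[/negPf-> /negPf->].
Qed.

Lemma push_spec a e : let a' := ceval (push e) a in
  [/\ a' 8 0 = (a 8 0).+1, forall i, a' 4 i = if i == a 8 0 then eval a e else a 4 i
    & forall j i, (j \notin [:: 4; 8]) -> a' j i = a j i].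
Proof.
split=> [||j i]; rewrite /= /put //= ?addn1 //.
by rewrite !inE => /norP[/negPf-> /negPf->].
Qed.

Lemma repush_spec a : env a -> (forall v, a 1 v = inv v) -> let a' := ceval repush a in
  (forall j i, (j \notin [:: 4; 8]) -> a' j i = a j i) /\
  if a 9 0 + a 10 0 == 0 then a' 8 0 = a 8 0 /\ forall i, a' 4 i = a 4 i else
  [/\ a' 8 0 = a 8 0 + 3, forall i, i < a 8 0 -> a' 4 i = a 4 i, a' 4 (a 8 0) = a 7 0,
      a' 4 (a 8 0).+1 = (a 7 0).+1 & a' 4 (a 8 0).+2 = inv (P (a 7 0)).+1].
Proof.
move=> ea a1; rewrite /repush -[ceval (If _ _) a]/(if a 9 0 + a 10 0 == 0 then a else
  ceval (push (Arr 1 (eadd (eP ex) (Cst 1)))) (ceval (push (eadd ex (Cst 1))) (ceval (push ex) a))).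
case: eqP => // _.
have [p8 p4 pE] := push_spec a ex; move: (ceval _ a) p8 p4 pE => b b8 b4 bE.
have [p8 p4 pE] := push_spec b (eadd ex (Cst 1)).
rewrite [eval b _](_ : _ = (a 7 0).+1) in p4; last by rewrite -[LHS]/(b 7 0 + 1) addn1 bE.
move: (ceval _ b) p8 p4 pE => d d8 d4 dE.
have ed : env d by split=> [y|]; rewrite dE // bE //; [apply: (proj1 ea)|apply: (proj2 ea)].
have [p8 p4 pE] := push_spec d (Arr 1 (eadd (eP ex) (Cst 1))).
rewrite [eval d _](_ : _ = inv (P (a 7 0)).+1) in p4; last first.
  rewrite -[LHS]/(d 1 (eval d (eP ex) + 1)) eval_eP // dE // bE // a1 addn1.
  by rewrite -[eval d ex]/(d 7 0) dE // bE.
move: (ceval _ d) p8 p4 pE => e e8 e4 eE.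
split=> [j i jn|]; first by rewrite eE // dE // bE.
rewrite e8 d8 b8; split=> [|i lti|||]; rewrite ?e4 ?d4 ?b4 ?d8 ?b8 ?eqxx //; first lia.
- by have [-> -> ->] : [/\ i == (a 8 0).+2 = false, i == (a 8 0).+1 = false
     & i == a 8 0 = false] by split; lia.
- by have [-> ->] : a 8 0 == (a 8 0).+2 = false /\ a 8 0 == (a 8 0).+1 = false by lia.
- by have -> : (a 8 0).+1 == (a 8 0).+2 = false by lia.
Qed.

Lemma main_body_spec a : env a -> (forall v, a 1 v = inv v) ->
  let x := a 4 (a 8 0).-1 in
  let unsettled c := ~~ settled n T P inv (candidates a) c x in
  let a' := ceval main_body a in
  [/\ forall c y, candidates a' c y = advance n T P inv (candidates a) x c y,
      forall j i, (j < 2) || (j == 5) || (j == 6) -> a' j i = a j i,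
      forall i, i < (a 8 0).-1 -> a' 4 i = a 4 i
    & if unsettled false || unsettled true then
      [/\ a' 8 0 = (a 8 0).-1 + 3, a' 4 (a 8 0).-1 = x, a' 4 (a 8 0).-1.+1 = x.+1
        & a' 4 (a 8 0).-1.+2 = inv (P x).+1]
      else a' 8 0 = (a 8 0).-1].
Proof.
move=> [a0 a5] a1 x unsettled.
rewrite -[ceval main_body a]/(ceval repush (ceval bump (ceval test (ceval pop a)))).
have [p8 p7 pE] := pop_spec a; move: (ceval pop a) p8 p7 pE => b b8 b7 bE.
have eb : env b by split=> [y|]; rewrite bE.
have b1 v : b 1 v = inv v by rewrite bE.
have bu c : settled n T P inv (candidates b) c (b 7 0) = ~~ unsettled c.
  rewrite negbK b7; apply: settled_ext => c' y.
  by rewrite /candidates bE //; case: c'.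
have [t9 t10 tE] := test_spec eb b1; move: (ceval test b) t9 t10 tE => d d9 d10 dE.
rewrite !bu !negbK in d9 d10.
have d7 : d 7 0 = x by rewrite dE.
have [e2 e3 eE] := bump_spec d; rewrite d7 d9 d10 in e2 e3.
move: (ceval bump d) e2 e3 eE => e e2 e3 eE.
have ee : env e by split=> [y|]; rewrite eE // dE // ?(proj1 eb) ?(proj2 eb).
have e1 v : e 1 v = inv v by rewrite eE // dE.
have [fE f48] := repush_spec ee e1; move: (ceval repush e) fE f48 => f fE.
rewrite !eE // d7 d9 d10 !dE // b8.
have -> : (nat_of_bool (unsettled false) + unsettled true == 0) =
  ~~ (unsettled false || unsettled true) by case: (unsettled false); case: (unsettled true).
have f4 i : e 4 i = a 4 i by rewrite eE // dE // bE.
move=> f48; split.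
- move=> c y; rewrite /candidates /advance fE; last by case: c.
  by case: c; rewrite ?e2 ?e3 dE // bE //; case: eqP.
- move=> j i ja; have ne m : m \in [:: 2; 3; 4; 7; 8; 9; 10] -> j != m.
    by rewrite !inE => mi; apply/eqP; lia.
  by rewrite fE ?eE ?dE ?bE // !inE !negb_or ?ne.
- move=> i lti; case: ifP f48 => [_ [_ ->]|_ [_ H _ _ _]]; first exact: f4.
  by rewrite H.
- by case: ifP f48 => [/negPf -> []|/negPn -> [-> _ -> -> ->]].
Qed.

End Matcher.

(** * Correctness and running time *)

Lemma perm321_ext N s s' : (forall x, 0 < x <= N -> s x = s' x) -> perm321 N s -> perm321 N s'.
Proof.
move=> ss' [rng surj inj inv exc def]; split.
- by move=> x rx; rewrite -ss' //; apply: rng.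
- by move=> v /surj[x rx <-]; exists x; rewrite // ss'.
- by move=> x y rx ry; rewrite -!ss' //; apply: inj.
- by move=> x y x0 ltxy leyN; rewrite -!ss'; [apply: inv|lia..].
- by move=> x rx; rewrite -ss' // => /(exc x rx)[y ry lty]; exists y; rewrite // -ss' //; lia.
- by move=> x rx; rewrite -ss' // => /(def x rx)[y ry lty]; exists y; rewrite // -ss' //; lia.
Qed.

Lemma pos_embedding_ext k n P P' T T' f :
  (forall x, 0 < x <= k -> P x = P' x) -> (forall t, 0 < t <= n -> T t = T' t) ->
  pos_embedding k n P T f -> pos_embedding k n P' T' f.
Proof.
move=> PP' TT' [rng pos val]; split=> // x y rx ry.
by rewrite -!PP' // -!TT' ?rng //; apply: val.
Qed.

Section Invariants.

Variables (n k : nat) (input : nat -> nat).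

Let T t := input t.+1.
Let P x := input (n + x.+1).

Hypotheses (HT : perm321 n T) (HP : perm321 k P).

Definition init_inv (a : state) :=
  [/\ env n input a, a 6 0 = k, a 7 0 <= k,
      forall c y, candidates a c y = (a 7 0 < y <= k)
    & [/\ forall y, a 7 0 < y <= k -> a 1 (P y) = y,
          forall v, a 1 v != 0 -> a 7 0 < a 1 v <= k /\ P (a 1 v) = v
        & forall y, a 7 0 < y <= k -> a 4 y.-1 = y]].

Lemma init_inv_step a : init_inv a -> a 7 0 != 0 ->
  init_inv (ceval init_body a) /\ ceval init_body a 7 0 < a 7 0.
Proof.
move=> [[a0 a5] a6 a7 aR [aI aV aS]] x0.
set x := a 7 0 in x0 a7 aR aI aV aS *.
set a' := ceval init_body a.
have rx : 0 < x <= k by lia.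
have Px : a 0 (a 5 0 + (1 + a 7 0)) = P x by rewrite a0 a5.
have a'7 : a' 7 0 = x.-1 by rewrite /a' /= /put /= subn1.
have a'1 v : a' 1 v = if v == P x then x else a 1 v by rewrite /a' /= /put /= Px.
have a'4 i : a' 4 i = if i == x.-1 then x else a 4 i by rewrite /a' /= /put /= -subn1.
have a'R c y : candidates a' c y = if y == x then 1 else candidates a c y.
  by case: c; rewrite /a' /= /candidates /= /put.
have a'E j i : j \in [:: 0; 5; 6] -> a' j i = a j i.
  by rewrite /a' !inE => /or3P[] /eqP->.
move: a' a'7 a'1 a'4 a'R a'E => a' a'7 a'1 a'4 a'R a'E.
rewrite a'7; split; last lia.
split; rewrite ?a'7 ?a'E //; try lia.
- by split=> [y|]; rewrite a'E.
- by move=> c y; rewrite a'R aR; case: eqP => [->|ne]; lia.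
- split=> [y ry|v|y ry].
  + rewrite a'1; case: eqP => [/(perm321_inj HP)|neq]; first by move=> ->; lia.
    have neyx : y != x by apply: contra_not_neq neq => ->.
    by apply: aI; lia.
  + rewrite a'1; case: (v =P P x) => [-> _|_ nz]; first by split=> //; lia.
    by have [? ?] := aV _ nz; split=> //; lia.
  + rewrite a'4; case: eqP => [|neq]; first lia.
    by apply: aS; lia.
Qed.

Variable (inv : nat -> nat).

(** An unsettled point always waits on the stack, so an empty stack means that everything is
    settled. *)
Definition main_inv (a : state) :=
  [/\ env n input a, a 6 0 = k, forall v, a 1 v = inv v,
      forall c y, ~~ (0 < y <= k) -> candidates a c y = 0
    & [/\ forall c y, 0 < y <= k -> 0 < candidates a c y <= n.+1,
          forall c y, settled n T P inv (candidates a) c y \/ exists2 i, i < a 8 0 & a 4 i = y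
        & forall f, pos_embedding k n P T f -> lower_bound k T P f (candidates a)]].

Lemma init_inv_final a : init_inv a -> a 7 0 = 0 -> (forall v, a 1 v = inv v) ->
  main_inv (ceval (Put 8 (Cst 0) (var 6)) a).
Proof.
move=> [ea a6 _ aR [_ _ aS]] x0 a1; rewrite x0 in aR aS.
set b := ceval _ a; have bE j i : j != 8 -> b j i = a j i.
  by move=> /negPf j8; rewrite /b /= /put j8.
have b8 : b 8 0 = k by rewrite /b /= /put /=.
have bR c y : candidates b c y = (0 < y <= k) by rewrite -(aR c) /candidates bE //; case: c.
move: b bE b8 bR => b bE b8 bR; split.
- by split=> [y|]; rewrite bE //; [apply: (proj1 ea)|apply: (proj2 ea)].
- by rewrite bE.
- by move=> v; rewrite bE.
- by move=> c y /negPf ny; rewrite bR ny.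
- split=> [c y ry|c y|f [rng _ _] y ry]; first by rewrite bR ry.
    case: (boolP (0 < y <= k)) => [ry|/negPf nry]; last by left; rewrite /settled bR nry.
    by right; exists y.-1; rewrite ?b8 ?bE ?aS //; lia.
  by rewrite bR ry; case/andP: (rng y ry).
Qed.

Hypotheses (T0 : T 0 = 0) (k_gt0 : 0 < k).
Hypothesis (invP : forall v, inv v != 0 -> 0 < inv v <= k /\ P (inv v) = v).
Hypothesis (invK : forall x, 0 < x <= k -> inv (P x) = x).

(** An advance replaces the popped entry by three, a net growth of two, and lowers the sum by at
    least 1; the weight 4 outweighs the growth. *)
Definition potential (a : state) :=
  4 * (\sum_(y < k.+1) ((n.+1 - candidates a false y) + (n.+1 - candidates a true y))) + a 8 0.

Lemma sum_decrease N (F G : nat -> nat) x d : x < N ->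
  (forall y, y < N -> y != x -> F y = G y) -> F x + d <= G x ->
  \sum_(y < N) F y + d <= \sum_(y < N) G y.
Proof.
move=> ltx eqFG leF; rewrite (bigD1 (Ordinal ltx)) // [leqRHS](bigD1 (Ordinal ltx)) //=.
rewrite addnAC leq_add //; apply/eq_leq/eq_bigr => y ne.
by apply: eqFG; rewrite ?ltn_ord // -[x]/(val (Ordinal ltx)) val_eqE.
Qed.

Lemma main_inv_step a : main_inv a -> a 8 0 != 0 ->
  main_inv (ceval main_body a) /\ potential (ceval main_body a) < potential a.
Proof.
move=> [ea a6 a1 aout [arng aset alb]] sp0.
have [] := main_body_spec ea a1.
set x := a 4 _; set a' := ceval main_body a => a'R a'E a'4.
move: a' a'R a'E a'4 => a' a'R a'E a'4 a'sp.
have ea' : env n input a' by split=> [y|]; rewrite a'E //; [apply: (proj1 ea)|apply: (proj2 ea)].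
have a'6 : a' 6 0 = k by rewrite a'E.
have a'1 v : a' 1 v = inv v by rewrite a'E.
(* Only a real point with a finite candidate can be unsettled, so advances never pass [n.+1]. *)
have uns_rng c : ~~ settled n T P inv (candidates a) c x ->
    0 < x <= k /\ candidates a c x <= n.
  rewrite /settled !negb_or => /and3P[nz le _]; split; last by rewrite leqNgt.
  by apply: contraNT nz => nrx; rewrite aout.
have a'R0 c y : y != x -> candidates a' c y = candidates a c y.
  by move=> /negPf ne; rewrite a'R /advance ne addn0.
case: (boolP (~~ settled n T P inv (candidates a) false x ||
              ~~ settled n T P inv (candidates a) true x)) a'sp => [uns|]; last first.
  rewrite negb_or !negbK => /andP[set0 set1] a'8.
  have a'Ra c y : candidates a' c y = candidates a c y.
    rewrite a'R /advance; case: eqP => [->|_] /=; rewrite ?addn0 //.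
    by case: c; rewrite ?set0 ?set1 addn0.
  split; last first.
    rewrite /potential a'8; under eq_bigr => y _ do rewrite !a'Ra.
    by rewrite ltn_add2l; lia.
  split=> // [c y nry|]; first by rewrite a'Ra aout.
  split=> [c y ry|c y|f /alb lb y ry]; rewrite ?a'Ra; [exact: arng| |exact: lb].
  (* The popped slot held [x], settled in both colours; all other slots survive. *)
  rewrite (settled_ext _ _ _ _ _ _ a'Ra); case: (aset c y) => [|[i lti <-]]; first by left.
  case: (ltngtP i (a 8 0).-1) => [lti'|?|->]; [|lia|left; by case: c].
  by right; exists i; rewrite ?a'8 // a'4.
move=> [a'8 s0 s1 s2].
have rx : 0 < x <= k by case/orP: uns => /uns_rng[].
split; last first.
  rewrite /potential a'8.
  have := @sum_decrease k.+1
    (fun y => (n.+1 - candidates a' false y) + (n.+1 - candidates a' true y))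
    (fun y => (n.+1 - candidates a false y) + (n.+1 - candidates a true y)) x 1 _ _ _.
  move=> H; suff : \sum_(y < k.+1) (n.+1 - candidates a' false y + (n.+1 - candidates a' true y)) + 1
    <= \sum_(y < k.+1) (n.+1 - candidates a false y + (n.+1 - candidates a true y)) by lia.
  apply: H => [|y _ ne|]; [lia|by rewrite !a'R0|].
  rewrite !a'R /advance eqxx /=.
  by case/orP: uns => uns; have [_ le] := uns_rng _ uns; rewrite uns; lia.
split=> // [c y nry|].
  by rewrite a'R0 ?aout //; apply: contraNneq nry => ->.
split=> [c y ry|c y|f Hf].
- rewrite a'R /advance; have := arng c y ry; case: eqP => [->|_] /=; last by rewrite addn0.
  case: (boolP (settled _ _ _ _ _ c x)) => [_|uc]; first by rewrite addn0.
  by have [_] := uns_rng c uc; lia.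
- case: (eqVneq y x) => [->|nex]; first by right; exists (a 8 0).-1; [lia|].
  case: (eqVneq y x.+1) => [->|neS]; first by right; exists (a 8 0).-1.+1; [lia|].
  case: (eqVneq y (inv (P x).+1)) => [->|neI]; first by right; exists (a 8 0).-1.+2; [lia|].
  rewrite (settled_ext _ _ _ _ _ _ a'R).
  case: (aset c y) => [sy|[i lti ey]]; first left.
    exact: (advance_settled HP invP invK aout rx sy).
  right; exists i; first lia.
  rewrite a'4 //; case: (ltngtP i (a 8 0).-1) => // [|ei]; first lia.
  by case/eqP: nex; rewrite -ey ei.
- move=> y ry; rewrite a'R.
  apply: (advance_lower_bound HT HP invP invK Hf) => // [c|c z rz|z rz].
  + by apply: aout.
  + by case/andP: (arng c z rz).
  + exact: alb.
Qed.

(** With everything settled, a finite candidate at [k] is read out by [color_embedding]; conversely,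
    an embedding bounds the candidate at [k] in its own colour. *)
Lemma main_inv_final a : main_inv a -> a 8 0 = 0 ->
  ((candidates a false k <= n) || (candidates a true k <= n)) <->
  exists f, pos_embedding k n P T f.
Proof.
move=> [ea a6 a1 aout [arng aset alb]] sp0.
have allset c y : settled n T P inv (candidates a) c y.
  by case: (aset c y) => // -[i]; rewrite sp0.
have rpos c y : 0 < y <= k -> 0 < candidates a c y by move=> /arng-/(_ c)/andP[].
split=> [fin|[f Hf]].
  have [c0 fin0] : exists c0, candidates a c0 k <= n.
    by case/orP: fin; [exists false|exists true].
  by eexists; apply: (color_embedding HP invK rpos allset fin0).
have := alb f Hf k; rewrite k_gt0 leqnn => /(_ isT) lb.
have [rng _ _] := Hf; have := rng k; rewrite k_gt0 leqnn => /(_ isT)/andP[_ fk].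
by have := leq_trans lb fk; case: image_color => ->; rewrite ?orbT.
Qed.

End Invariants.

Lemma potential_bound n k a : a 8 0 = k -> (potential n k a).+1 <= 10 * (k.+1 * n.+1).
Proof.
move=> a8; rewrite /potential a8.
have : \sum_(y < k.+1) ((n.+1 - candidates a false y) + (n.+1 - candidates a true y))
       <= k.+1 * (n.+1 + n.+1).
  rewrite -[X in _ <= X * _](card_ord k.+1) -sum_nat_const; apply: leq_sum => y _.
  by rewrite leq_add ?leq_subr.
rewrite mulnDr; have : k.+1 <= k.+1 * n.+1 by apply: leq_pmulr.
lia.
Qed.

Lemma matcher_correct n k (input : nat -> nat) (a : state) :
  0 < n -> 0 < k -> (forall y, a 0 y = input y) -> (forall j y, 0 < j < 5 -> a j y = 0) ->
  input 0 = n -> input 1 = k ->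
  perm321 n (fun t => input t.+1) -> perm321 k (fun x => input (n + x.+1)) ->
  exists a' t, [/\ run matcher a a' t,
    a' 11 0 = 1 <->
      (exists f, pos_embedding k n (fun x => input (n + x.+1)) (fun t => input t.+1) f)
    & t <= ccost matcher * (10 * (k.+1 * n.+1))].
Proof.
move=> n_gt0 k_gt0 a0 aj in0 in1 HT0 HP0.
(* Array 0 after the prelude. Cell 1 belongs to neither permutation, so both survive. *)
pose input' y := if y == 1 then 0 else input y.
have eT t : 0 < t <= n -> input t.+1 = input' t.+1 by case: t.
have eP x : 0 < x <= k -> input (n + x.+1) = input' (n + x.+1).
  by move=> rx; rewrite /input' (_ : n + x.+1 == 1 = false) //; lia.
have HT := perm321_ext eT HT0; have HP := perm321_ext eP HP0.
have [t1 r1 le1] := @run_loopfree prelude a isT.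
set a1 := ceval prelude a in r1.
have a10 y : a1 0 y = input' y by rewrite /a1 /= /put /= a0.
have a15 : a1 5 0 = n by rewrite /a1 /= /put /= a0.
have a16 : a1 6 0 = k by rewrite /a1 /= /put /= a0.
have a17 : a1 7 0 = k by rewrite /a1 /= /put /= a0.
have a1j j y : 0 < j < 5 -> a1 j y = 0.
  by move=> rj; rewrite -(aj j y rj) /a1 /= /put; case: j rj => [|[|[|[|[]]]]].
move: (a1) a10 a15 a16 a17 a1j r1 => {}a1 a10 a15 a16 a17 a1j r1.
have I1 : init_inv n k input' a1.
  split=> // [|c y|]; rewrite ?a17 //.
    by rewrite /candidates a1j; [lia|case: c].
  split=> [y|v|y]; rewrite ?a17; [lia|by rewrite a1j|lia].
have [a2 [t2 [r2 I2 x0 le2]]] :=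
  @run_while (init_inv n k input') (fun b => b 7 0) ex init_body a1 isT
    (fun b Ib => init_inv_step HP Ib) I1.
rewrite a17 in le2; rewrite -[eval a2 ex]/(a2 7 0) in x0.
have [_ _ _ _ [invK invP _]] := I2; rewrite x0 in invK invP.
have I3 := init_inv_final I2 x0 (fun=> erefl).
have r3 : run (Put 8 (Cst 0) (var 6)) a2 _ _ := run_put _ _ _ _.
rewrite -[put a2 _ _ _]/(ceval (Put 8 (Cst 0) (var 6)) a2) in r3.
have a38 : ceval (Put 8 (Cst 0) (var 6)) a2 8 0 = k by case: I2.
move: (ceval _ a2) I3 r3 a38 => a3 I3 r3 a38.
have [a4 [t4 [r4 I4 sp0 le4]]] :=
  @run_while (main_inv n k input' (a2 1)) (potential n k) (var 8) main_body a3 isT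
    (fun b Ib => main_inv_step HT HP erefl k_gt0 invP invK Ib) I3.
have [t5 r5 le5] := @run_loopfree answer a4 isT.
exists (ceval answer a4), (t1 + (t2 + (ccost (Put 8 (Cst 0) (var 6)) + (t4 + t5)))); split.
- exact: run_seq r1 (run_seq r2 (run_seq r3 (run_seq r4 r5))).
- have [[_ a45] a46 _ _ _] := I4.
  have := main_inv_final HP k_gt0 invK I4 sp0.
  have -> : ceval answer a4 11 0 =
    ((candidates a4 false k <= n) || (candidates a4 true k <= n)).
    by rewrite /candidates /= /put /= a45 a46 addn1 !ltnS;
       case: (a4 2 k <= n); case: (a4 3 k <= n).
  move=> fin; split=> [out1|[f Hf]].
    have [|f Hf] := proj1 fin; first by case: (_ || _) out1.
    by exists f; apply: pos_embedding_ext Hf => x rx; rewrite ?eT ?eP.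
  suff -> : (candidates a4 false k <= n) || (candidates a4 true k <= n) by [].
  by apply/fin; exists f; apply: pos_embedding_ext Hf.
set X := 10 * _.
have leX : k.+1 <= X by rewrite /X mulnCA leq_pmulr.
have X0 : 0 < X by apply: leq_trans leX.
have lePot := potential_bound n a38; rewrite -/X in lePot.
have -> : ccost matcher = ccost prelude + (ccost (While ex init_body) +
  (ccost (Put 8 (Cst 0) (var 6)) + (ccost (While (var 8) main_body) + ccost answer))) by [].
move: (ccost prelude) (ccost (While ex init_body)) (ccost (Put 8 (Cst 0) (var 6)))
  (ccost (While (var 8) main_body)) (ccost answer)
  le1 le2 le4 le5 => c1 c2 c3 c4 c5 le1 le2 le4 le5.
rewrite !mulnDl; apply: leq_add; first exact: leq_trans le1 (leq_pmulr _ X0).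
apply: leq_add; first exact: leq_trans le2 (leq_mul (leqnn _) leX).
apply: leq_add; first exact: leq_pmulr.
apply: leq_add; first exact: leq_trans le4 (leq_mul (leqnn _) lePot).
exact: leq_trans le5 (leq_pmulr _ X0).
Qed.

(** * Assembling loader, matcher and output *)

Lemma init_mem_text n k (tau : 'S_n) (pi : 'S_k) t :
  0 < t <= n -> init_mem tau pi t.+1 = oneval tau t.
Proof. by case: t => //= t lt; rewrite /init_mem /= nth_cat size_one_line lt. Qed.

Lemma init_mem_pattern n k (tau : 'S_n) (pi : 'S_k) x :
  0 < x <= k -> init_mem tau pi (n + x.+1) = oneval pi x.
Proof.
case: x => //= x ltx; rewrite !addnS /init_mem /= nth_cat size_one_line.
by rewrite ltnNge leq_addr /= addKn.
Qed.

Lemma init_mem_out n k (tau : 'S_n) (pi : 'S_k) y :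
  n + k + 2 <= y -> init_mem tau pi y = 0.
Proof.
by move=> ley; apply: nth_default; rewrite size_cat /= size_cat !size_one_line; lia.
Qed.

Definition finish : seq instr := ecode (var 11) 1 ++ [:: IConst 0 0; IAdd 0 0 1].

Definition core : seq instr :=
  loader 2 ++ ccode matcher (2 + size (loader 2)) ++ finish.

(** The loader is correct for positive [n] and [k]. If [k = 0], the first jump leads to writing 1;
    if only [n = 0], the second leads to a halt with 0 still in cell 0. *)
Definition solver : program :=
  [:: IJz 1 (2 + size core).+1; IJz 0 (2 + size core)] ++ core ++
  [:: IHalt; IConst 0 1; IHalt].

(** The loader takes at most [size preload + 7 * (n + 40 * k)] steps and
    [n + 40 * k <= 41 * (k.+1 * n.+1)], whence 287; the 3 pays for the two initial tests and the
    halt. *)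
Definition solver_cost : nat := 3 + (size preload + 287) + 10 * ccost matcher + size finish.

Lemma core_spec n k (tau : 'S_n) (pi : 'S_k) P : 0 < n -> 0 < k ->
  avoids321 tau -> avoids321 pi -> code_at P 2 core ->
  exists m t, [/\ runs P 2 (init_mem tau pi) t (2 + size core) m,
    m 0 = 1 <-> contains tau pi & t + 3 <= solver_cost * (k.+1 * n.+1)].
Proof.
move=> n_gt0 k_gt0 av_tau av_pi /code_at_cat[at_l /code_at_cat[at_m]].
rewrite size_ccode => /code_at_cat[at_e at_f].
have eT t : 0 < t <= n -> oneval tau t = init_mem tau pi t.+1.
  by move=> rt; rewrite init_mem_text.
have eP x : 0 < x <= k -> oneval pi x = init_mem tau pi (n + x.+1).
  by move=> rx; rewrite init_mem_pattern.
have HT := perm321_ext eT (oneval_perm321 av_tau).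
have HP := perm321_ext eP (oneval_perm321 av_pi).
have [m1 [t1 [r1 rep1 leB le1]]] := loader_spec n_gt0 k_gt0 (erefl : init_mem tau pi 0 = n)
  (erefl : init_mem tau pi 1 = k) (@init_mem_out n k tau pi) erefl erefl at_l.
have [a' [t2 [r2 out le2]]] := @matcher_correct n k (init_mem tau pi)
  (fun j i => if j == 0 then init_mem tau pi i else 0) n_gt0 k_gt0 (fun=> erefl)
  ltac:(by case) erefl erefl HT HP.
have [m2 r2' rep2] := ccode_correct r2 leB cwf_matcher at_m rep1.
have [m3d m3x] := @ecode_spec _ _ (var 11) 1 m2 leB isT isT rep2.
have r3 := @runs_straight P _ m2 finish isT (proj2 (code_at_cat _ _ _ _) (conj at_e at_f)).
exists (effects m2 finish), (t1 + t2 + size finish); split.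
- have sz (s1 s2 s3 : seq instr) c : size s2 = c ->
    2 + size (s1 ++ s2 ++ s3) = 2 + size s1 + c + size s3.
    by move=> <-; rewrite !size_cat; lia.
  by rewrite (sz _ _ _ _ (size_ccode _ _)); apply: runs_trans (runs_trans r1 r2') r3.
- have -> : effects m2 finish 0 = a' 11 0.
    rewrite /finish effects_cat; move: (effects m2 _) m3d => m3 /= m3d.
    by rewrite !upd_eq upd_neq // m3d.
  rewrite contains_pos_embedding out.
  by split=> -[f Hf]; exists f; apply: pos_embedding_ext Hf => x rx; rewrite ?eT ?eP.
set K := k.+1 * n.+1.
have leK : 1 <= K /\ n + 40 * k <= 41 * K by rewrite /K; nia.
rewrite /solver_cost !mulnDl; move: le2; rewrite mulnA [ccost _ * 10]mulnC => le2.
have := leq_pmulr (size preload) (proj1 leK); have := leq_pmulr (size finish) (proj1 leK).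
move: (size finish) (size preload * K) (size preload) (10 * ccost matcher * K) le1 le2 => *.
lia.
Qed.

(* There is a RAM program P and a constant C such that, for all 321-avoiding
   tau of size n and pi of size k, P on input (tau, pi) halts within
   C*(k+1)*(n+1) = O(kn) steps and outputs M[0] = 1 iff tau contains pi. *)
Theorem theorem1 :
  exists (P : program) (C : nat),
    forall (n k : nat) (tau : 'S_n) (pi : 'S_k),
      avoids321 tau -> avoids321 pi ->
      exists m' : memory,
        exec (C * (k.+1 * n.+1)) P 0 (init_mem tau pi) = Some m' /\
        (m' 0 = 1 <-> contains tau pi).
Proof.
exists solver, solver_cost => n k tau pi av_tau av_pi.
have /code_at_cat[[Pk [Pn _]] /code_at_cat[at_c [Ph [Pa [Ph' _]]]]] := code_at_self solver.
have big : 3 <= solver_cost * (k.+1 * n.+1).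
  by apply: leq_trans (leq_pmulr _ _); rewrite // /solver_cost -!addnA leq_addr.
have rk := runs_jz (init_mem tau pi) Pk.
case: (posnP k) => [k0|k_gt0].
  have z : init_mem tau pi 1 == 0 by apply/eqP.
  rewrite z in rk.
  have ra := @runs_straight solver _ (init_mem tau pi) [:: IConst 0 1] isT (conj Pa I).
  exists (upd (init_mem tau pi) 0 1); split.
    by apply: runs_halt (runs_trans rk ra) _ big; rewrite addn1.
  split=> // _; apply/contains_pos_embedding; exists (fun=> 0).
  by split=> x; [lia|move=> y; lia|move=> y; lia].
have nk0 : init_mem tau pi 1 == 0 = false by apply: gtn_eqF.
rewrite nk0 in rk.
have rn := runs_jz (init_mem tau pi) Pn.
case: (posnP n) => [n0|n_gt0].
  have z : init_mem tau pi 0 == 0 by apply/eqP.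
  rewrite z in rn.
  exists (init_mem tau pi); split; first exact: runs_halt (runs_trans rk rn) Ph big.
  split=> [|/contains_pos_embedding[f [rng _ _]]]; first by rewrite (eqP z).
  by have := rng 1; lia.
have nn0 : init_mem tau pi 0 == 0 = false by apply: gtn_eqF.
rewrite nn0 in rn.
have [m [t [rc out le]]] := core_spec n_gt0 k_gt0 av_tau av_pi at_c.
exists m; split=> //; apply: runs_halt (runs_trans (runs_trans rk rn) rc) Ph _.
by rewrite addnC; apply: leq_trans le; rewrite -addnS.
Qed.
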